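(* Let $p,q,r$ be positive integers and $k_1,\ldots,k_r$ integers $\ge2$; put $|\mathbf{k}|=k_1+\cdots+k_r$ and, for $0\le j\le r$, $K_j=k_r+k_{r-1}+\cdots+k_{r+1-j}$ ($K_0=0$). Then \[ \psi(\{1\}_{q-1},k_1,\ldots,k_{r-1},k_r-1;p+1)-(-1)^{|\mathbf{k}|}\psi(\{1\}_{p-1},k_r,\ldots,k_2,k_1-1;q+1) \] \[ =\sum_{j=0}^{r-1}(-1)^{K_j}\sum_{i=1}^{k_{r-j}-2}(-1)^{i-1}T(\{1\}_{p-1},k_r,\ldots,k_{r+1-j},i+1)\,T(\{1\}_{q-1},k_1,\ldots,k_{r-j-1},k_{r-j}-i) \] \[ +\sum_{j=0}^{r-2}(-1)^{K_{j+1}}\Big\{T(\mathbf{b}_j)\,T(\mathbf{a}_j^{-}\circledast(1,1))-T(\mathbf{a}_j)\,T(\mathbf{b}_j^{-}\circledast(1,1))+2\delta_{p+j,\,q+r-j-2}\log(2)\,T(\mathbf{a}_j)T(\mathbf{b}_j)\Big\}, \] where $\mathbf{a}_j=(\{1\}_{p-1},k_r,k_{r-1},\ldots,k_{r-j})$ and $\mathbf{b}_j=(\{1\}_{q-1},k_1,\ldots,k_{r-j-1})$ (sequences like $k_r,\ldots,k_{r+1-j}$ are empty when $j=0$, and $k_1,\ldots,k_{r-j-1}$ is empty when $j=r-1$).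
   Context: ${\rm A}(k_1,\ldots,k_r;z)=2^r\sum_{1\le n_1<\cdots<n_r,\ n_i\equiv i \pmod 2}\frac{z^{n_r}}{n_1^{k_1}\cdots n_r^{k_r}}$; $\psi(k_1,\ldots,k_r;s)=\frac{1}{\Gamma(s)}\int_0^\infty t^{s-1}\frac{{\rm A}(k_1,\ldots,k_r;\tanh(t/2))}{\sinh t}\,dt$. For admissible $(k_1,\ldots,k_r)$ ($k_r\ge2$), $T(k_1,\ldots,k_r)=2^r\sum_{0<m_1<\cdots<m_r,\ m_i\equiv i\pmod 2}\frac{1}{m_1^{k_1}\cdots m_r^{k_r}}$. $\{1\}_j$ denotes $j$ repetitions of $1$. For an index $\mathbf{c}=(c_1,\ldots,c_d)$, $\mathbf{c}^-=(c_1,\ldots,c_{d-1},c_d-1)$. Multiple $T$-harmonic sums: $T_n(\emptyset)=1$; for odd depth $T_n(c_1,\ldots,c_{2m-1})=2\sum_{j=1}^n\frac{T_j(c_1,\ldots,c_{2m-2})}{(2j-1)^{c_{2m-1}}}$; for even depth $T_n(c_1,\ldots,c_{2m})=2\sum_{j=1}^{n-1}\frac{T_j(c_1,\ldots,c_{2m-1})}{(2j)^{c_{2m}}}$. In particular $T_n(1)=\sum_{j=1}^n\frac{2}{2j-1}$; let $S_n(1)=\sum_{j=1}^{n-1}\frac{2}{2j}$. Convoluted $T$-values with $(1,1)$: for $\mathbf{c}=(c_1,\ldots,c_d)$, $T(\mathbf{c}\circledast(1,1))=2\sum_{n\ge1}\frac{T_n(c_1,\ldots,c_{d-1})T_n(1)}{(2n)^{c_d+1}}$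 if $d$ is even and $=2\sum_{n\ge1}\frac{T_n(c_1,\ldots,c_{d-1})S_n(1)}{(2n-1)^{c_d+1}}$ if $d$ is odd. For positive integers $a,b$: $\delta_{a,b}=0$ if $a,b$ have the same parity, $\delta_{a,b}=-1$ if $a$ even and $b$ odd, $\delta_{a,b}=1$ if $a$ odd and $b$ even. *)

(* Defs.v *)
From HB Require Import structures.
From mathcomp Require Import all_boot all_order all_algebra.
From mathcomp Require Import all_classical all_reals all_analysis.

Set Implicit Arguments.
Unset Strict Implicit.
Unset Printing Implicit Defensive.

Import Order.TTheory GRing.Theory Num.Theory.
Import numFieldNormedType.Exports.

Local Open Scope classical_set_scope.
Local Open Scope ring_scope.

(* An index (k_1, ..., k_r) is the list [:: k_1; ...; k_r], so that k_i
   is [nth 0 k (i - 1)]. *)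

(* 1 <= n_1 < ... < n_r and n_i = i (mod 2) for 1 <= i <= r. *)
Definition alternating (n : seq nat) : bool :=
  path ltn 0%N n &&
  all (fun i => nth 0%N n i == i.+1 %[mod 2]) (iota 0 (size n)).

(* The infinite multiple sums are ordered by their largest variable: the value
   is the limit, as N grows, of the finite sum over n_1 < ... < n_r <= N. *)
Definition multA (R : realType) (k : seq nat) (z : R) : R :=
  limn (fun N : nat =>
    2 ^+ size k *
    \sum_(n : (size k).-tuple 'I_N.+1 | alternating (map val n))
      z ^+ last 0%N (map val n) /
      \prod_(i < size k) (val (tnth n i))%:R ^+ nth 0%N k i).

Definition multT (R : realType) (k : seq nat) : R :=
  limn (fun N : nat =>
    2 ^+ size k *
    \sum_(n : (size k).-tuple 'I_N.+1 | alternating (map val n))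
      (\prod_(i < size k) (val (tnth n i))%:R ^+ nth 0%N k i)^-1 : R).

Definition sinh (R : realType) (x : R) : R := (expR x - expR (- x)) / 2.
Definition cosh (R : realType) (x : R) : R := (expR x + expR (- x)) / 2.
Definition tanh (R : realType) (x : R) : R := sinh x / cosh x.

Definition Gamma (R : realType) (s : R) : R :=
  \int[@lebesgue_measure R]_(t in `]0, +oo[) (t `^ (s - 1) * expR (- t)).

Definition psi (R : realType) (k : seq nat) (s : R) : R :=
  (Gamma s)^-1 *
  \int[@lebesgue_measure R]_(t in `]0, +oo[)
    (t `^ (s - 1) * multA k (tanh (t / 2)) / sinh t).

(* T_n(c_1, ..., c_d) recurses on the last entry, hence on the reversed list:
   [harmT_rev R [:: c_d; ...; c_1] n]. *)
Fixpoint harmT_rev (R : realType) (c : seq nat) (n : nat) : R :=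
  match c with
  | [::] => 1
  | e :: c' =>
      if odd (size c) then
        2 * \sum_(1 <= j < n.+1) harmT_rev R c' j / (2 * j%:R - 1) ^+ e
      else
        2 * \sum_(1 <= j < n) harmT_rev R c' j / (2 * j%:R) ^+ e
  end.

Definition harmT (R : realType) (c : seq nat) (n : nat) : R :=
  harmT_rev R (rev c) n.

Definition harmS1 (R : realType) (n : nat) : R :=
  \sum_(1 <= j < n) 2 / (2 * j%:R).

(* The convoluted value of a nonempty index c with the index (1,1). *)
Definition convT11 (R : realType) (c : seq nat) : R :=
  let d := size c in
  let c' := take d.-1 c in
  let cd := last 0%N c in
  if odd d then
    2 * limn (fun N : nat => \sum_(1 <= n < N.+1)
          harmT R c' n * harmS1 R n / (2 * n%:R - 1) ^+ cd.+1)
  else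
    2 * limn (fun N : nat => \sum_(1 <= n < N.+1)
          harmT R c' n * harmT R [:: 1%N] n / (2 * n%:R) ^+ cd.+1).

(* c^- = (c_1, ..., c_{d-1}, c_d - 1) for a nonempty index c. *)
Definition decr_last (c : seq nat) : seq nat :=
  rcons (take (size c).-1 c) (last 0%N c).-1.

Definition parity_delta (R : realType) (a b : nat) : R :=
  if odd a == odd b then 0 else if odd a then 1 else -1.

(* Main.v *)
(* Substituting z = tanh (t / 2) turns dz / z into dt / sinh t and 2 dz / (1 - z^2)
   into dt, and log ((1 + z) / (1 - z)) into t.  Hence A({1}_p; z) = t^p / p! and
   psi (k; p + 1) is the integral of A({1}_p; z) A(k; z) / sinh t over t > 0.
   Lowering the last exponent of one factor raises that of the other by an
   integration by parts, at the cost of a boundary product T(..) T(..).  When a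
   last exponent reaches 1, one is left with
     integral (A(a^-) A(b, 1) - A(a, 1) A(b^-)) / sinh t
       = lim (A(a) A(b, 1) - A(b) A(a, 1)),   t -> +oo.
   Here A(a, 1; z) = T(a) t - E(a) + o(1), and an Abel-type argument with the
   nonnegative coefficients of T(a) L(z) - A(a, 1; z), where L(z) is
   log ((1 + z) / (1 - z)) or - log (1 - z^2) according to the parity of the depth,
   identifies E(a) with the convoluted value T(a^- o (1, 1)), up to the correction
   2 log 2 T(a) when the depth of a is odd. *)
Require Import Defs.
From HB Require Import structures.
From mathcomp Require Import all_boot all_order all_algebra.
From mathcomp Require Import all_classical all_reals all_analysis.
From mathcomp Require Import measurable_realfun.
From mathcomp Require Import ring lra zify.

Import Order.TTheory GRing.Theory Num.Theory.
Import numFieldNormedType.Exports.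

Local Open Scope ring_scope.

Set Implicit Arguments.
Unset Strict Implicit.
Unset Printing Implicit Defensive.

(** All functions involved are power series in z = tanh (t / 2) with nonnegative coefficients, so
    convergence questions become boundedness questions, and multiple sums are rearranged only at
    finite level, before any limit is taken. Two obstacles shape the analysis. First, 1 / sinh t
    blows up at 0; since A(k; z) has no constant term at positive depth, A / sinh extends
    continuously, and the extension is what gets integrated. Second, the integrand of the
    last-exponent-1 identity need not have constant sign; every integrand is dominated by C exp (- t
    / 2), and adding this function reduces to the nonnegative case. The bounds all come from one
    comparison: exponents at least 1 give A(k; z) <= A({1}_d; z) = t^d / d!, d being the depth. The
    signs (-1)^(K_j) count integrations by parts: using up an entry x takes x - 2 of them, a sign
    (-1)^x. Once all r entries have crossed from one factor to the other, the integral left over is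
    the second psi. *)

Section Coefficients.
Context {R : realType}.
Implicit Types (c : nat -> R) (s : seq nat) (m n : nat) (b : bool).

(** Appends a new largest variable [n]. As [series c n] stops before [n], the previous variable is
    strictly smaller; [b] is the parity imposed on [n], and the 2 is one of the factors of 2^r.
    Exponent 0 is allowed: it occurs after differentiating exponent 1. *)
Definition coef_step m b c : nat -> R :=
  fun n => if odd n == b then 2 * series c n / n%:R ^+ m else 0.

(* Indices are read from the right: [coef [:: k_r; ...; k_1] n] is the
   coefficient of [z ^+ n] in [multA [:: k_1; ...; k_r] z]. *)
Fixpoint coef s : nat -> R :=
  if s is m :: s' then coef_step m (odd (size s)) (coef s')
  else fun n => (n == 0%N)%:R.

Lemma series_0 c : series c 0 = 0.
Proof. by rewrite seriesEnat /= big_geq. Qed.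

Lemma coef_step_ge0 m b c : (forall n, 0 <= c n) ->
  forall n, 0 <= coef_step m b c n.
Proof.
move=> c0 n; rewrite /coef_step; case: ifP => // _.
by rewrite divr_ge0 ?exprn_ge0 ?mulr_ge0// seriesEnat sumr_ge0.
Qed.

Lemma coef_ge0 s n : 0 <= coef s n.
Proof. by elim: s n => [|m s IH] n /=; [case: eqP|exact: coef_step_ge0]. Qed.

Lemma coef_parity s n : odd n != odd (size s) -> coef s n = 0.
Proof.
case: s => [|m s] /=; first by case: n.
by rewrite /coef_step; case: eqP.
Qed.

Lemma alternating_rcons (t : seq nat) x : Defs.alternating (rcons t x) =
  [&& Defs.alternating t, (last 0 t < x)%N & odd x == odd (size t).+1].
Proof.
rewrite /Defs.alternating rcons_path size_rcons -[X in iota _ X]addn1 iotaD.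
rewrite all_cat /= andbT add0n.
rewrite nth_rcons ltnn eqxx.
have -> : all (fun i => nth 0%N (rcons t x) i == i.+1 %[mod 2])
            (iota 0 (size t)) =
          all (fun i => nth 0%N t i == i.+1 %[mod 2]) (iota 0 (size t)).
  apply: eq_in_all => i; rewrite mem_iota add0n leq0n /= => it.
  by rewrite nth_rcons it.
rewrite !modn2 (inj_eq (can_inj oddb)) -!andbA; congr (_ && _).
by rewrite andbCA.
Qed.

Lemma sum_rcons_tuple (T : finType) d (P : pred (seq T)) (G : seq T -> R) :
  \sum_(n : d.+1.-tuple T | P n) G n =
  \sum_(n : d.-tuple T) \sum_(x | P (rcons n x)) G (rcons n x).
Proof.
rewrite pair_big_dep /=.
rewrite (reindex (fun p : d.-tuple T * T => [tuple of rcons p.1 p.2])) //=.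
exists (fun n : d.+1.-tuple T =>
  ([tuple of belast (thead n) (behead_tuple n)], last (thead n) (behead n))).
- move=> [n x] _ /=; congr pair; last first.
    rewrite /thead (tnth_nth x) /=.
    by case: n => -[|a n] //= _; rewrite last_rcons.
  apply: val_inj => /=; rewrite /thead (tnth_nth x) /=.
  by case: n => -[|a n] //= _; rewrite belast_rcons.
- by move=> n _; apply: val_inj; case/tupleP: n => a n /=; rewrite theadE -lastI.
Qed.

Lemma alternating_sumE s N (g : nat -> R) :
  2 ^+ size s * \sum_(n : (size s).-tuple 'I_N.+1 | Defs.alternating (map val n))
    (g (last 0%N (map val n)) /
     \prod_(i < size s) (val (tnth n i))%:R ^+ nth 0%N s i) =
  \sum_(0 <= n < N.+1) coef (rev s) n * g n.
Proof.
have nthE d t (n : d.-tuple 'I_N.+1) :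
    \prod_(i < d) (val (tnth n i))%:R ^+ nth 0%N t i =
    \prod_(i < d) (nth 0%N (map val n) i)%:R ^+ nth 0%N t i :> R.
  apply: eq_bigr => i _; rewrite (tnth_nth ord0) (nth_map ord0)//.
  by rewrite size_tuple.
under eq_bigr do rewrite nthE.
elim/last_ind: s g => [|s m IH] g.
  rewrite expr0 mul1r big_nat_recl//= mul1r [X in _ + X]big1 ?addr0; last first.
    by move=> i _; rewrite mul0r.
  rewrite (eq_bigl predT) => [|n]; last by rewrite (tuple0 n).
  rewrite (big_pred1 [tuple]) => [|n]; last by apply/esym/eqP; exact: tuple0.
  by rewrite big_ord0 divr1.
rewrite rev_rcons size_rcons.
rewrite (sum_rcons_tuple (size s)
  (fun n : seq 'I_N.+1 => Defs.alternating (map val n))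
  (fun n : seq 'I_N.+1 => g (last 0%N (map val n)) /
   \prod_(i < (size s).+1) (nth 0%N (map val n) i)%:R ^+ nth 0%N (rcons s m) i)).
(* Summing out the last variable [x] above a fixed previous one [l] leaves a sum of smaller depth
   with weight [g']; this is why the induction is over all weights [g]. *)
pose g' l := \sum_(x < N.+1 | (l < x)%N && (odd x == odd (size s).+1))
  2 * g x / x%:R ^+ m.
transitivity (\sum_(0 <= n < N.+1) coef (rev s) n * g' n); last first.
  under eq_bigr do rewrite /g' mulr_sumr.
  under [RHS]eq_bigr => n _.
    rewrite /= size_rev /coef_step (fun_if (fun x => x * g n)) mul0r.
    over.
  rewrite -big_mkcond /= [in RHS]big_mkord.
  rewrite big_mkord (exchange_big_dep (fun x : 'I__ => odd x == odd (size s).+1)) /=.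
    apply: eq_bigr => x /eqP ox.
    rewrite seriesEnat mulr_sumr !mulr_suml.
    rewrite big_mkord.
    rewrite [RHS](big_ord_widen N.+1
      (fun j => 2 * coef (rev s) j / x%:R ^+ m * g x) (ltnW (ltn_ord x))).
    apply: eq_big => [j|j _]; first by rewrite ox eqxx andbT.
    by ring.
  by move=> i j _ /andP[].
rewrite -IH exprS -mulrA mulrCA; congr (_ * _).
rewrite mulr_sumr [RHS]big_mkcond; apply: eq_bigr => n _.
have sn : size (map val n) = size s by rewrite size_map size_tuple.
under eq_bigl => x do rewrite map_rcons alternating_rcons sn.
case: ifP => an /=; last by rewrite big_pred0_eq mulr0.
rewrite mulr_sumr mulr_suml; apply: eq_bigr => x _.
rewrite map_rcons last_rcons big_ord_recr /= nth_rcons sn ltnn eqxx.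
rewrite nth_rcons ltnn eqxx.
under eq_bigr => i _ do rewrite !nth_rcons sn ltn_ord.
by rewrite invfM; ring.
Qed.

(** The two image filters are equal, so no convergence is assumed and default values agree as well;
    hence [multA_coef] holds for every [z]. *)
Lemma limn_shiftS (u : nat -> R) : limn (fun n => u n.+1) = limn u.
Proof.
have E := cvg_shiftS u; congr (lim _); apply/seteqP; split.
  suff : (u x @[x --> \oo] --> u n.+1 @[n --> \oo])%classic by [].
  by rewrite -E.
suff : (u n.+1 @[n --> \oo] --> u x @[x --> \oo])%classic by [].
by rewrite E.
Qed.

Lemma eq_limn (u v : nat -> R) : u =1 v -> limn u = limn v.
Proof. by move=> /funext ->. Qed.

Lemma multA_coef s : multA s = fun z : R => limn (pseries (coef (rev s)) z).
Proof.
apply/funext => z; rewrite /multA -[RHS]limn_shiftS; apply: eq_limn => N.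
apply: etrans (alternating_sumE s N (fun n => z ^+ n)) _.
by rewrite /pseries seriesEnat.
Qed.

Lemma multT_multA s : multT R s = multA s 1.
Proof.
apply: eq_limn => N; congr (_ * _); apply: eq_bigr => n _.
by rewrite expr1n div1r.
Qed.

Lemma pseries1 (c : nat -> R) : pseries c 1 = series c.
Proof.
by rewrite /pseries; congr series; apply/funext => n /=; rewrite expr1n mulr1.
Qed.

Lemma multT_coef s : multT R s = limn (series (coef (rev s))).
Proof. by rewrite multT_multA multA_coef pseries1. Qed.

(* Both bounds of summation in [harmT] amount to [n_d < 2 n]. *)
Lemma harmT_coef s n : (0 < n)%N -> harmT R s n = series (coef (rev s)) n.*2.
Proof.
have seriesD c k : series c k.+1.*2 = series c k.*2 + c k.*2 + c k.*2.+1 :> R.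
  by rewrite seriesEnat doubleS /= !big_nat_recr.
rewrite /harmT; elim: (rev s) n => [|m {}s IH] n n0.
  rewrite seriesEnat /= big_ltn ?double_gt0//= big_nat big1 ?addr0// => i.
  by case: i.
have c1 i : odd i != odd (size s) -> series (coef s) i.+1 = series (coef s) i.
  by move=> oi; rewrite seriesEnat /= big_nat_recr//= coef_parity// addr0.
move: n {n0} => n; rewrite /=; case: ifP => os; rewrite big_distrr /=.
- elim: n => [|n IHn]; first by rewrite big_geq// seriesEnat /= big_geq.
  rewrite big_nat_recr//= seriesD IHn /coef_step /= odd_double /= addr0.
  rewrite IH// doubleS c1 ?oddS ?odd_double ?os//.
  rewrite mulrA; congr (_ + _ / _ ^+ _).
  by rewrite -!natr1 -muln2 natrM; ring.
- elim: n => [|n IHn]; first by rewrite big_geq// seriesEnat /= big_geq.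
  rewrite seriesD /coef_step /= odd_double /= addr0 -/(coef_step _ _ _).
  case: n IHn => [|n] IHn.
    have -> c : series c 0.*2 = 0 :> R by rewrite seriesEnat /= big_geq.
    by rewrite big_geq// seriesEnat /= big_geq// mulr0 mul0r addr0.
  by rewrite big_nat_recr//= IHn IH// -mul2n natrM mulrA.
Qed.
End Coefficients.

(** * Power series with nonnegative coefficients on the unit interval *)

Section PowerSeries.
Context {R : realType}.
Implicit Types (c : nat -> R) (x y z : R).

Definition psum c x : R := limn (pseries c x).

Definition summable_in c := (forall n, 0 <= c n) /\
  forall x, 0 <= x -> x < 1 -> cvgn (pseries c x).

Lemma pseries_nondecreasing c x : (forall n, 0 <= c n) -> 0 <= x ->
  nondecreasing_seq (pseries c x).
Proof.
move=> c0 x0; apply: (@nondecreasing_series _ _ predT) => n _ _.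
by rewrite mulr_ge0 ?exprn_ge0.
Qed.

Lemma summable_in_cvg c x : summable_in c -> `|x| < 1 -> cvgn (pseries c x).
Proof.
move=> [c0 cv] x1; apply: (@is_cvg_pseries_inside _ _ ((`|x| + 1) / 2)).
  by apply: cv; have := normr_ge0 x; lra.
by rewrite [ltRHS]ger0_norm; have := normr_ge0 x; lra.
Qed.

Lemma pseries_le_psum c x n : summable_in c -> 0 <= x -> x < 1 ->
  pseries c x n <= psum c x.
Proof.
move=> [c0 cv] x0 x1; apply: nondecreasing_cvgn_le; last exact: cv.
exact: pseries_nondecreasing.
Qed.

Lemma psum_ge0 c x : summable_in c -> 0 <= x -> x < 1 -> 0 <= psum c x.
Proof.
move=> sc x0 x1; apply: le_trans (pseries_le_psum 0 sc x0 x1).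
by rewrite /pseries seriesEnat /= big_geq.
Qed.

Lemma le_summable_in c c' : (forall n, 0 <= c' n <= c n) ->
  summable_in c -> summable_in c'.
Proof.
move=> cc [c0 cv]; split=> [n|x x0 x1]; first by case/andP: (cc n).
have xn n : 0 <= x ^+ n by rewrite exprn_ge0.
apply: series_le_cvg (cv x x0 x1) => n /=; rewrite ?mulr_ge0//.
  by case/andP: (cc n).
by rewrite ler_wpM2r//; case/andP: (cc n).
Qed.

Lemma bounded_summable_in c :
  (forall n, 0 <= c n) ->
  (forall x, 0 <= x -> x < 1 -> exists M, forall n, pseries c x n <= M) ->
  summable_in c.
Proof.
move=> c0 bc; split=> // x x0 x1; have [M cM] := bc x x0 x1.
apply: nondecreasing_is_cvgn; first exact: pseries_nondecreasing.
by exists M => _ [n _ <-].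
Qed.

Lemma summable_in_series c : summable_in c -> summable_in (series c).
Proof.
move=> sc; apply: bounded_summable_in => [n|x x0 x1].
  by rewrite seriesEnat /= sumr_ge0// => i _; case: sc.
exists (x * psum c x / (1 - x)) => N; rewrite ler_pdivlMr; last by lra.
apply: le_trans (ler_wpM2l x0 (pseries_le_psum N sc x0 x1)).
have -> : x * pseries c x N =
    pseries (series c) x N * (1 - x) + x ^+ N * series c N.
  elim: N => [|N IH].
    by rewrite /pseries !seriesEnat /= !big_geq// !(mulr0, mul0r) addr0.
  rewrite /pseries seriesSr mulrDr -/(pseries c x) IH [series _ N.+1]seriesSr.
  by rewrite -/(pseries (series c) x) seriesSr exprS /=; ring.
rewrite lerDl mulr_ge0 ?exprn_ge0// seriesEnat /= sumr_ge0// => i _.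
by case: sc.
Qed.

Lemma summable_inZ c k : 0 <= k -> summable_in c ->
  summable_in (fun n => k * c n).
Proof.
move=> k0 [c0 cv]; split=> [n|x x0 x1]; first by rewrite mulr_ge0.
rewrite (_ : pseries _ x = fun n => k * pseries c x n); last first.
  by apply/funext => n; rewrite /pseries !seriesEnat /= mulr_sumr;
    apply: eq_bigr => i _; rewrite mulrA.
by apply: is_cvgMr; exact: cv.
Qed.

(** With [w] halfway between [x] and 1, the factorization of w^(i+1) - x^(i+1) gives (i + 1) x^i (w
    - x) <= w^(i+1), so the differentiated series at [x] is controlled by the original one at
    [w]. *)
Lemma summable_in_diffs c : summable_in c -> summable_in (pseries_diffs c).
Proof.
move=> sc; apply: bounded_summable_in => [n|x x0 x1].
  by rewrite /pseries_diffs mulr_ge0//; case: sc.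
pose w := (1 + x) / 2; have w0 : 0 <= w by rewrite /w; lra.
have w1 : w < 1 by rewrite /w; lra.
have xw : x < w by rewrite /w; lra.
have wx : 0 < w - x by rewrite subr_gt0.
exists (psum c w / (w - x)) => N; rewrite ler_pdivlMr//.
apply: le_trans (pseries_le_psum N.+1 sc w0 w1).
rewrite /pseries !seriesEnat /= big_nat_recl// mulr_suml expr0 mulr1.
rewrite -[leLHS]add0r lerD//; first by case: sc.
apply: ler_sum => i _; rewrite /pseries_diffs.
rewrite (_ : i.+1%:R * _ * _ * _ = c i.+1 * (i.+1%:R * x ^+ i * (w - x)));
  last by ring.
rewrite ler_wpM2l//; first by case: sc.
have H : w ^+ i.+1 - x ^+ i.+1 = (w - x) * \sum_(j < i.+1) w ^+ (i - j) * x ^+ j.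
  by rewrite subrXX; congr (_ * _); apply: eq_bigr => j _; rewrite subSS.
apply: (@le_trans _ _ (w ^+ i.+1 - x ^+ i.+1)); last first.
  by rewrite lerBlDr lerDl exprn_ge0.
rewrite H mulrC ler_wpM2l ?(ltW wx)//.
rewrite mulr_natl -[X in _ *+ X]card_ord -sumr_const.
apply: ler_sum => j _.
rewrite -{1}(subnK (_ : j <= i)%N) -1?ltnS// exprD ler_wpM2r ?exprn_ge0//.
by rewrite lerXn2r// ltW.
Qed.

Lemma is_derive_psum c x : summable_in c -> `|x| < 1 ->
  is_derive x 1 (psum c) (psum (pseries_diffs c) x).
Proof.
move=> sc x1.
have K1 : `|(`|x| + 1) / 2| < 1.
  by rewrite ger0_norm; have := normr_ge0 x; lra.
apply: (@pseries_snd_diffs _ c ((`|x| + 1) / 2)).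
- exact: summable_in_cvg.
- by apply: summable_in_cvg => //; exact: summable_in_diffs.
- by apply: summable_in_cvg => //; do 2 apply: summable_in_diffs.
- by rewrite [ltRHS]ger0_norm; have := normr_ge0 x; lra.
Qed.

Definition shift c : nat -> R := fun n => if n is n'.+1 then c n' else 0.

Lemma pseries_shift c x : pseries (shift c) x =
  fun n => if n is n'.+1 then x * pseries c x n' else 0.
Proof.
apply/funext => -[|n]; rewrite /pseries seriesEnat /=; first by rewrite big_geq.
rewrite big_nat_recl// mul0r add0r seriesEnat /= mulr_sumr.
by apply: eq_bigr => i _; rewrite exprS mulrCA.
Qed.

Lemma cvg_pseries_shift c x : cvgn (pseries c x) ->
  (pseries (shift c) x @ \oo --> x * psum c x)%classic.
Proof.
move=> cv; rewrite pseries_shift -cvg_shiftS; exact: cvgMr.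
Qed.

Lemma psum_shift c x : cvgn (pseries c x) -> psum (shift c) x = x * psum c x.
Proof. by move=> /cvg_pseries_shift; apply: cvg_lim. Qed.

Lemma psumB c c' x : cvgn (pseries c x) -> cvgn (pseries c' x) ->
  psum (fun n => c n - c' n) x = psum c x - psum c' x.
Proof.
move=> cv cv'; apply: cvg_lim => //.
rewrite (_ : pseries _ x = fun n => pseries c x n - pseries c' x n); last first.
  apply/funext => n; rewrite /pseries !seriesEnat /= -sumrB.
  by apply: eq_bigr => i _; rewrite mulrBl.
exact: cvgB.
Qed.

Lemma eq_psum c c' x : c =1 c' -> psum c x = psum c' x.
Proof. by move=> /funext ->. Qed.

Lemma psum0 c : psum c 0 = c 0%N.
Proof.
apply: cvg_lim => //; rewrite -cvg_shiftS.
rewrite (_ : [sequence _]_n = fun=> c 0%N); first exact: cvg_cst.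
apply/funext => n; rewrite /pseries seriesEnat /= big_nat_recl//= expr0 mulr1.
by rewrite big1 ?addr0// => i _; rewrite expr0n mulr0.
Qed.

Lemma pseries_cvg_at1 c n : (pseries c x n @[x --> 1^'-] --> series c n)%classic.
Proof.
rewrite -pseries1; apply: cvg_at_left_filter.
elim: n => [|n IH].
  rewrite (_ : (fun x => _) = fun=> pseries c 1 0); first exact: cvg_cst.
  by apply/funext => x; rewrite /pseries !seriesEnat /= !big_geq.
rewrite (_ : (fun x => _) = (fun x => pseries c x n + c n * x ^+ n)); last first.
  by apply/funext => x; rewrite /pseries seriesSr.
rewrite {2}/pseries seriesSr; apply: cvgD => //.
by apply: cvgMr; exact: exprn_continuous.
Qed.

(** Abel's theorem. For nonnegative coefficients [psum c x] lies between the polynomial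
    [pseries c x n], continuous at 1, and the full sum at 1, so no summation by parts is
    required. *)
Lemma psum_cvg_at1 c : summable_in c -> cvgn (series c) ->
  (psum c x @[x --> 1^'-] --> limn (series c))%classic.
Proof.
move=> sc cv; apply/cvgrPdist_le => e e0.
have [n hn] : exists n, limn (series c) - e / 2 <= series c n.
  have /cvgrPdist_le/(_ (e / 2)) [|N _ /(_ N (leqnn N))] := cv.
    by rewrite divr_gt0.
  by move=> h; exists N; move: h; rewrite ler_norml; lra.
have H := @pseries_cvg_at1 c n.
near=> x.
have x0 : 0 <= x by near: x; exact: nbhs_left_ge.
have x1 : x < 1 by near: x; exact: nbhs_left_lt.
have h1 := pseries_le_psum n sc x0 x1.
have h2 : series c n - e / 2 <= pseries c x n.
  have : `|series c n - pseries c x n| <= e / 2.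
    near: x; move/cvgrPdist_le : H; apply; by rewrite divr_gt0.
  by rewrite ler_norml; lra.
have h3 : psum c x <= limn (series c).
  apply: ler_lim; [by case: sc => _; apply|exact: cv|].
  apply: nearW => m; rewrite /pseries !seriesEnat /=; apply: ler_sum => i _.
  by rewrite ler_piMr ?exprn_ile1 ?(ltW x1)//; case: sc.
by rewrite ger0_norm; lra.
Unshelve. all: end_near. Qed.

End PowerSeries.

(** * Differential equations of the generating functions in z *)

Section GeneratingFunctions.
Context {R : realType}.
Implicit Types (c : nat -> R) (s : seq nat) (t x : R).

Lemma summable_coef_step m b c : summable_in c -> summable_in (coef_step m b c).
Proof.
move=> sc; have := summable_inZ (ler0n R 2) (summable_in_series sc).
apply: le_summable_in => n.
have c0 : forall n, 0 <= c n by case: sc.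
have s0 : 0 <= series c n by rewrite seriesEnat /= sumr_ge0.
rewrite coef_step_ge0//= /coef_step; case: ifP => _; last by rewrite mulr_ge0.
case: n s0 => [|n] s0; first by rewrite seriesEnat /= big_geq// !(mulr0, mul0r).
rewrite ler_piMr ?mulr_ge0// invf_le1 ?exprn_gt0// exprn_ege1//.
by rewrite ler1n.
Qed.

Lemma summable_coef s : summable_in (coef s : nat -> R).
Proof.
elim: s => [|m s IH]; last exact: summable_coef_step.
apply: bounded_summable_in => [n|x x0 x1]; first exact: (coef_ge0 [::]).
exists 1 => -[|n]; rewrite /pseries seriesEnat /=; first by rewrite big_geq.
by rewrite big_nat_recl//= mul1r big1 ?addr0// => i _; rewrite mul0r.
Qed.

Lemma coef_step0 m b c : coef_step m b c 0 = 0.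
Proof. by rewrite /coef_step seriesEnat /= big_geq// mulr0 mul0r if_same. Qed.

Lemma coef0 m s : coef (m :: s) 0 = 0 :> R.
Proof. exact: coef_step0. Qed.

Lemma diffs_coef_step m b c n :
  pseries_diffs (coef_step m.+1 b c) n = coef_step m b c n.+1.
Proof.
rewrite /pseries_diffs /coef_step; case: ifP => _; last by rewrite mulr0.
by rewrite exprS invfM; field; rewrite expf_neq0//= pnatr_eq0.
Qed.

Lemma summable_coefS m s : summable_in (fun n => coef (m :: s) n.+1 : R).
Proof.
rewrite (_ : (fun n => _) = pseries_diffs (coef (m.+1 :: s))); last first.
  by apply/funext => n; rewrite /= diffs_coef_step.
by apply: summable_in_diffs; exact: summable_coef.
Qed.

(** Differentiating exponent 1 leaves exponent 0, that is, partial sums of [c] on one parity class;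
    multiplying by 1 - x^2 takes differences of terms two apart. Stated for any parity [b], since
    the logarithmic series [harm_coef false] needs it too. *)
Lemma psum_diffs_coef_step1 b c x : summable_in c -> `|x| < 1 ->
  (1 - x ^+ 2) * psum (pseries_diffs (coef_step 1 b c)) x =
  psum (fun n => coef_step 0 b c n.+1 - shift (coef_step 0 b c) n) x.
Proof.
move=> sc x1; set e := pseries_diffs _.
have se : summable_in e by apply: summable_in_diffs; exact: summable_coef_step.
have cv := summable_in_cvg se x1.
have cv1 : cvgn (pseries (shift e) x) by apply/cvgP/cvg_pseries_shift.
have cv2 : cvgn (pseries (shift (shift e)) x) by apply/cvgP/cvg_pseries_shift.
transitivity (psum (fun n => e n - shift (shift e) n) x).
  by rewrite psumB// !psum_shift//; ring.
apply: eq_psum => n; rewrite /e diffs_coef_step; congr (_ - _).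
by case: n => [|[|n]] //=; rewrite ?coef_step0// diffs_coef_step.
Qed.

Lemma coef_cons m s :
  coef (m :: s) = coef_step m (odd (size s).+1) (coef s) :> (nat -> R).
Proof. by []. Qed.

(** The differences two apart telescope to 2 (c_n + c_(n-1)), and c_(n-1) vanishes by parity. This
    is dA(k, 1; z) / dz = 2 A(k; z) / (1 - z^2). *)
Lemma psum_diffs_coef1 s x : `|x| < 1 ->
  (1 - x ^+ 2) * psum (pseries_diffs (coef (1%N :: s))) x =
  2 * psum (coef s) x.
Proof.
move=> x1; rewrite coef_cons psum_diffs_coef_step1//; last exact: summable_coef.
have cv := summable_in_cvg (summable_coef s) x1.
transitivity (psum (fun n => 2 * coef s n) x); last first.
  apply: cvg_lim => //.
  rewrite (_ : pseries _ x = fun n => 2 * pseries (coef s) x n); last first.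
    apply/funext => n; rewrite /pseries !seriesEnat /= mulr_sumr.
    by apply: eq_bigr => i _; rewrite mulrA.
  by apply: cvgMr; exact: cv.
have c0 n : odd n != odd (size s) -> coef s n = 0 :> R by apply: coef_parity.
apply: eq_psum => -[|n] /=.
  rewrite subr0 /coef_step /= seriesEnat /= big_nat1 expr0 divr1.
  by case: (odd (size s)) (c0 0%N) => //= ->//; rewrite mulr0.
rewrite /coef_step /= negbK !expr0 !divr1 seriesEnat /= !big_nat_recr//=.
have := c0 n; have := c0 n.+1; rewrite /=.
case: (odd n); case: (odd (size s)) => /= h1 h2.
- by rewrite h1// subrr mulr0.
- by rewrite h2//; ring.
- by rewrite h2//; ring.
- by rewrite h1// subrr mulr0.
Qed.

(** Larger exponents only shrink coefficients. The all-ones index has a closed form in t, so this is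
    the source of every growth bound below. *)
Lemma le_coef s : all (leq 1) s ->
  forall n, coef s n <= coef (nseq (size s) 1%N) n :> R.
Proof.
elim: s => [|m s IH]//= /andP[m0 /IH {}IH] n; rewrite /coef_step size_nseq.
case: ifP => // _; case: n => [|n].
  by rewrite !seriesEnat /= !big_geq// mulr0 !mul0r.
rewrite ler_pM//.
- by rewrite mulr_ge0// seriesEnat /= sumr_ge0// => i _; exact: coef_ge0.
- by rewrite ler_wpM2l// !seriesEnat /=; apply: ler_sum => i _.
- by rewrite lef_pV2 ?posrE ?exprn_gt0// ler_weXn2l// ler1n.
Qed.

Lemma le_psum c c' x : summable_in c -> summable_in c' ->
  (forall n, c n <= c' n) -> 0 <= x -> x < 1 -> psum c x <= psum c' x.
Proof.
move=> sc sc' cc x0 x1; apply: ler_lim.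
- by case: sc => _; apply.
- by case: sc' => _; apply.
apply: nearW => n; rewrite /pseries !seriesEnat /=.
by apply: ler_sum => i _; rewrite ler_wpM2r ?exprn_ge0.
Qed.

End GeneratingFunctions.

(** * Derivative rules for functions written as explicit abstractions *)

Section Derivatives.
Context {R : realType}.
Implicit Types (f g : R -> R) (x a b : R).

Lemma is_derive_val f x a b :
  is_derive x 1 f a -> a = b -> is_derive x 1 f b.
Proof. by move=> fa <-. Qed.

Lemma is_deriveDx f g x a b : is_derive x 1 f a -> is_derive x 1 g b ->
  is_derive x 1 (fun x => f x + g x) (a + b).
Proof. by move=> fa gb; exact: (is_deriveD fa gb). Qed.

Lemma is_deriveBx f g x a b : is_derive x 1 f a -> is_derive x 1 g b ->
  is_derive x 1 (fun x => f x - g x) (a - b).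
Proof. by move=> fa gb; exact: (is_deriveB fa gb). Qed.

Lemma is_deriveMx f g x a b : is_derive x 1 f a -> is_derive x 1 g b ->
  is_derive x 1 (fun x => f x * g x) (f x * b + g x * a).
Proof. by move=> fa gb; exact: (is_deriveM fa gb). Qed.

Lemma is_deriveZx k f x a : is_derive x 1 f a ->
  is_derive x 1 (fun x => k * f x) (k * a).
Proof. by move=> fa; exact: (is_deriveZ k fa). Qed.

Lemma is_deriveVx f x a : f x != 0 -> is_derive x 1 f a ->
  is_derive x 1 (fun x => (f x)^-1) (- a / f x ^+ 2).
Proof.
move=> f0 fa; have := is_deriveV f0 fa.
by rewrite /GRing.scale /= mulNr mulrC mulNr.
Qed.

Lemma is_derive_compx f g x a b : is_derive (g x) 1 f a -> is_derive x 1 g b ->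
  is_derive x 1 (fun x => f (g x)) (a * b).
Proof. by move=> fa gb; exact: is_derive1_comp. Qed.

Lemma is_derive_expZ k x :
  is_derive x 1 (fun x => expR (k * x)) (k * expR (k * x)).
Proof.
apply: (is_derive_val
  (is_derive_compx (is_derive_expR _) (is_deriveZx k (is_derive_id _ _)))).
by rewrite mulr1 mulrC.
Qed.

Lemma is_derive_exprn n x :
  is_derive x 1 (fun x => x ^+ n) (n%:R * x ^+ n.-1).
Proof.
apply: DeriveDef; first exact: exprn_derivable.
by rewrite exp_derive /GRing.scale /= mulr1.
Qed.

Lemma is_derive_continuous f x a : is_derive x 1 f a -> {for x, continuous f}.
Proof.
move=> fa; apply: differentiable_continuous; apply/derivable1_diffP.
exact: ex_derive.
Qed.

End Derivatives.

(** * The substitution z = tanh (t / 2) *)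

Section HyperbolicTangent.
Context {R : realType}.
Implicit Types (t x : R).

Local Notation th t := (Defs.tanh (t / 2)).

Lemma thE t : th t = (expR (t / 2) - expR (- (t / 2))) /
                     (expR (t / 2) + expR (- (t / 2))).
Proof.
rewrite /Defs.tanh /Defs.sinh /Defs.cosh; field.
by rewrite gt_eqF// addr_gt0 ?expR_gt0.
Qed.

Lemma expR_cosh_gt0 t : 0 < expR (t / 2) + expR (- (t / 2)).
Proof. by rewrite addr_gt0 ?expR_gt0. Qed.

Lemma cosh_neq0 t : expR (t / 2) + expR (- (t / 2)) != 0.
Proof. by rewrite gt_eqF// expR_cosh_gt0. Qed.

Lemma expR_mulN (t : R) : expR t * expR (- t) = 1.
Proof. by rewrite -expRD subrr expR0. Qed.

Lemma subr1_th2 t : 1 - th t ^+ 2 = 4 / (expR (t / 2) + expR (- (t / 2))) ^+ 2.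
Proof.
rewrite thE; have := cosh_neq0 t; have := expR_mulN (t / 2).
set u := expR _; set v := expR _ => uv uv0.
have -> : 4 = 4 * (u * v) by rewrite uv mulr1.
by field.
Qed.

Lemma th_lt1 t : `|th t| < 1.
Proof.
rewrite thE normrM normfV (gtr0_norm (expR_cosh_gt0 t)).
rewrite ltr_pdivrMr ?expR_cosh_gt0// mul1r.
have := expR_gt0 (t / 2); have := expR_gt0 (- (t / 2)).
by rewrite ltr_norml; lra.
Qed.

Lemma th_ge0 t : 0 <= t -> 0 <= th t.
Proof.
move=> t0; rewrite thE; apply: divr_ge0; last exact: ltW (expR_cosh_gt0 t).
by rewrite subr_ge0 ler_expR; lra.
Qed.

Lemma th0 : th 0 = 0 :> R.
Proof. by rewrite thE mul0r oppr0 subrr mul0r. Qed.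

Lemma sinh_th t : Defs.sinh t = 2 * th t / (1 - th t ^+ 2).
Proof.
rewrite subr1_th2 thE; have := cosh_neq0 t.
rewrite /Defs.sinh.
have -> : expR t = expR (t / 2) ^+ 2 by rewrite expr2 -expRD -splitr.
have -> : expR (- t) = expR (- (t / 2)) ^+ 2.
  by rewrite expr2 -expRD -opprD -splitr.
by move=> uv0; field.
Qed.

Lemma sinh_gt0 t : 0 < t -> 0 < Defs.sinh t.
Proof.
by move=> t0; rewrite /Defs.sinh divr_gt0// subr_gt0 ltr_expR; lra.
Qed.

Lemma is_derive_th t : is_derive t 1 (fun t => th t) ((1 - th t ^+ 2) / 2).
Proof.
pose f t := expR (2^-1 * t) : R; pose g t := expR (- 2^-1 * t) : R.
rewrite (_ : (fun t => th t) = fun t => (f t - g t) * (f t + g t)^-1); last first.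
  by apply/funext => u; rewrite thE /f /g mulNr ![_^-1 * _]mulrC.
have df x : is_derive x 1 f (2^-1 * f x) by exact: is_derive_expZ.
have dg x : is_derive x 1 g (- 2^-1 * g x) by exact: is_derive_expZ.
have fg0 : f t + g t != 0 by rewrite gt_eqF// addr_gt0 ?expR_gt0.
apply: (is_derive_val (is_deriveMx (is_deriveBx (df t) (dg t))
  (is_deriveVx (f := fun x => f x + g x) fg0 (is_deriveDx (df t) (dg t))))).
rewrite subr1_th2.
have -> : expR (- (t / 2)) = g t by rewrite /g mulNr mulrC.
have -> : expR (t / 2) = f t by rewrite /f mulrC.
have : f t * g t = 1 by rewrite /f /g mulNr expR_mulN.
move: fg0; set u := f t; set v := g t => fg0 uv.
have -> : 4 = 4 * (u * v) by rewrite uv mulr1.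
by field.
Qed.

Lemma th_cvg1 : ((fun t : R => th t) t @[t --> +oo] --> 1^'-)%classic.
Proof.
have h : ((fun t : R => th t) t @[t --> +oo] --> (1 : R))%classic.
  (* Lower barrier: with v = exp (- t / 2) and u v = 1, one has 1 - tanh (t / 2) = 2 v / (u + v) <=
     2 v^2. *)
  have e0 : (1 - 2 * expR (- t) @[t --> +oo] --> (1 - 2 * 0 : R))%classic.
    by apply: cvgB; [exact: cvg_cst|apply: cvgMr; exact: cvgr_expR].
  rewrite mulr0 subr0 in e0.
  have e1 : ((fun _ : R => 1 : R) t @[t --> +oo] --> (1 : R))%classic.
    exact: cvg_cst.
  apply: squeeze_cvgr e0 e1; apply: nearW => t.
  have /ltW := th_lt1 t; rewrite ler_norml => /andP[_ ->]; rewrite andbT.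
  have -> : - t = - (t / 2) + - (t / 2) by rewrite -opprD -splitr.
  rewrite expRD thE -subr_ge0.
  have := expR_gt0 (t / 2); have := expR_gt0 (- (t / 2)).
  have := expR_mulN (t / 2); have := cosh_neq0 t.
  set u := expR (t / 2); set v := expR (- (t / 2)) => uv0 uv v0 u0.
  rewrite (_ : _ - _ = 2 * v ^+ 3 / (u + v)); last first.
    have -> : (u - v) / (u + v) = 1 - 2 * (u * v) * v / (u + v).
      by rewrite uv; field.
    by field.
  by rewrite !(divr_ge0, mulr_ge0, exprn_ge0, addr_ge0)// ltW.
move=> A A1; have H : (\forall y \near (1 : R), y < 1 -> A y)%classic := A1.
have H' : (\forall t \near +oo, th t < 1 -> A (th t))%classic := h _ H.
change (\forall t \near +oo, A (th t))%classic.
apply: filterS H' => t; apply.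
by have := th_lt1 t; rewrite ltr_norml => /andP[].
Qed.

Lemma psum_th_cvg (c : nat -> R) : summable_in c -> cvgn (series c) ->
  (psum c (th t) @[t --> +oo] --> limn (series c))%classic.
Proof. by move=> sc cv; exact: cvg_comp th_cvg1 (psum_cvg_at1 sc cv). Qed.

(* The converse (Tauberian) half of Abel's theorem, elementary because the
   coefficients are nonnegative. *)
Lemma bounded_psum_th (c : nat -> R) M : summable_in c ->
  (forall t, 0 <= t -> psum c (th t) <= M) -> cvgn (series c).
Proof.
move=> sc cM; apply: nondecreasing_is_cvgn.
  by apply: (@nondecreasing_series _ _ predT) => n _ _; case: sc.
exists M => _ [n _ <-].
have H := cvg_comp _ _ th_cvg1 (pseries_cvg_at1 (c := c) (n := n)).
apply: (cvgr_to_le H); near=> t.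
have t0 : 0 <= t by near: t; exact: nbhs_pinfty_ge.
have := th_lt1 t; rewrite ltr_norml => /andP[_ z1].
exact: le_trans (pseries_le_psum n sc (th_ge0 t0) z1) (cM t t0).
Unshelve. all: end_near. Qed.

End HyperbolicTangent.

(** * The generating functions as functions of t *)

Section GeneratingFunctionsOfTime.
Context {R : realType}.
Implicit Types (c : nat -> R) (s : seq nat) (t x : R).

Local Notation th t := (Defs.tanh (t / 2)).

(* [polyA [:: k_r; ...; k_1] t] is A(k_1, ..., k_r; tanh(t/2)). *)
Definition polyA s t : R := psum (coef s) (th t).

(* For [t != 0] this is [polyA s t / sinh t]; the junk value of the quotient at
   [0] is replaced by the limit. *)
Definition polyA_sinh s t : R :=
  psum (fun n => coef s n.+1) (th t) * ((1 - th t ^+ 2) / 2).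

Lemma polyA_multA s t : multA (rev s) (th t) = polyA s t.
Proof. by rewrite multA_coef revK. Qed.

Lemma is_derive_psum_th c t : summable_in c ->
  is_derive t 1 (fun t => psum c (th t))
    (psum (pseries_diffs c) (th t) * ((1 - th t ^+ 2) / 2)).
Proof.
move=> sc; apply: is_derive_compx (is_derive_th t).
exact: is_derive_psum (th_lt1 t).
Qed.

Lemma is_derive_polyA1 s t : is_derive t 1 (polyA (1%N :: s)) (polyA s t).
Proof.
apply: (is_derive_val (is_derive_psum_th t (summable_coef _))).
have := psum_diffs_coef1 s (th_lt1 t) => h.
by rewrite mulrA mulrC [_ * (1 - _)]mulrC h mulKf// pnatr_eq0.
Qed.

Lemma is_derive_polyA m s t :
  is_derive t 1 (polyA (m.+1 :: s)) (polyA_sinh (m :: s) t).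
Proof.
apply: (is_derive_val (is_derive_psum_th t (summable_coef _))).
rewrite /polyA_sinh; congr (_ * _); apply: eq_psum => n.
by rewrite coef_cons diffs_coef_step.
Qed.

Lemma polyA_sinhE m s t : 0 < t ->
  polyA_sinh (m :: s) t = polyA (m :: s) t / Defs.sinh t.
Proof.
move=> t0; have st0 := sinh_gt0 t0; rewrite /polyA_sinh /polyA.
have cv := summable_in_cvg (summable_coefS m s) (th_lt1 t).
have -> : psum (coef (m :: s)) (th t) =
    th t * psum (fun n => coef (m :: s) n.+1) (th t).
  by rewrite -psum_shift//; apply: eq_psum => -[|n]; first exact: coef0.
rewrite sinh_th in st0 *.
have z0 : th t != 0.
  by apply: contraTneq st0 => ->; rewrite mulr0 mul0r ltxx.
have z1 : 1 - th t ^+ 2 != 0.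
  by apply: contraTneq st0 => ->; rewrite invr0 mulr0 ltxx.
by field; rewrite z0 z1.
Qed.

Lemma polyA_sinh_ge0 m s t : 0 <= t -> 0 <= polyA_sinh (m :: s) t.
Proof.
move=> t0; have := th_lt1 t; rewrite ltr_norml => /andP[z0 z1].
rewrite mulr_ge0//; first exact: psum_ge0 (summable_coefS m s) (th_ge0 t0) z1.
by rewrite divr_ge0// subr_ge0 exprn_ile1 ?(th_ge0 t0) ?(ltW z1).
Qed.

Lemma polyA_ge0 s t : 0 <= t -> 0 <= polyA s t.
Proof.
move=> t0; have := th_lt1 t; rewrite ltr_norml => /andP[z0 z1].
exact: psum_ge0 (summable_coef s) (th_ge0 t0) z1.
Qed.

Lemma polyA_at0 m s : polyA (m :: s) 0 = 0.
Proof. by rewrite /polyA th0 psum0 coef0. Qed.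

Lemma polyA_nil t : polyA [::] t = 1.
Proof.
apply: cvg_lim => //; rewrite -cvg_shiftS.
rewrite (_ : [sequence _]_n = fun=> 1); first exact: cvg_cst.
apply/funext => n; rewrite /pseries seriesEnat /= big_nat_recl//= expr0 mulr1.
by rewrite big1 ?addr0// => i _; rewrite mul0r.
Qed.

Lemma polyA_nseq1 d t : polyA (nseq d 1%N) t = t ^+ d / d`!%:R.
Proof.
elim: d t => [|d IH] t; first by rewrite polyA_nil expr0 divr1.
apply/eqP; rewrite -subr_eq0; apply/eqP.
pose f t : R := polyA (nseq d.+1 1%N) t - d.+1`!%:R^-1 * (id t * t ^+ d).
have f' x : is_derive x 1 f 0.
  rewrite /f.
  apply: (is_derive_val (is_deriveBx (is_derive_polyA1 _ _)
    (is_deriveZx _ (is_deriveMx (is_derive_id _ _) (is_derive_exprn d x))))).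
  have -> : x * (d%:R * x ^+ d.-1) = d%:R * x ^+ d.
    by case: (d) => [|d']; rewrite ?mul0r ?mulr0// mulrCA -exprS.
  have u0 : d`!%:R != 0 :> R by rewrite pnatr_eq0 -lt0n fact_gt0.
  have d0 : d.+1%:R != 0 :> R by rewrite pnatr_eq0.
  rewrite IH factS natrM -natr1 in d0 *.
  by move: u0; set u := _%:R => u0; field; rewrite u0 d0.
have -> : polyA (nseq d.+1 1%N) t - t ^+ d.+1 / (d.+1)`!%:R = f t.
  by rewrite /f /= exprS [_^-1 * _]mulrC.
rewrite (is_derive_0_is_cst t 0 f') /f polyA_at0 mul0r mulr0 subrr.
by [].
Qed.

Lemma polyA_le s t : all (leq 1) s -> 0 <= t ->
  polyA s t <= t ^+ size s / (size s)`!%:R.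
Proof.
move=> s1 t0; rewrite -polyA_nseq1 /polyA.
have := th_lt1 t; rewrite ltr_norml => /andP[z0 z1].
by apply: le_psum (summable_coef _) (summable_coef _) _ (th_ge0 t0) z1;
  exact: le_coef.
Qed.

Lemma continuous_polyA s : continuous (polyA s).
Proof.
by move=> t; exact: (is_derive_continuous (is_derive_psum_th t (summable_coef s))).
Qed.

Lemma continuous_polyA_sinh m s : continuous (polyA_sinh (m :: s)).
Proof.
move=> t.
have D := is_deriveZx 2^-1 (is_deriveBx (is_derive_cst (1 : R) t 1)
  (is_deriveMx (is_derive_th t) (is_derive_th t))).
have := is_derive_continuous
  (is_deriveMx (is_derive_psum_th t (summable_coefS m s)) D).
congr (continuous_at _ _); apply/funext => u.
by rewrite /polyA_sinh /= [in RHS]expr2 [(_ - _) / 2]mulrC.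
Qed.

End GeneratingFunctionsOfTime.

(** * Improper integrals of exponentially dominated functions *)

Section Integrals.
Context {R : realType}.
Implicit Types (f h : R -> R) (t u C : R).

Local Notation mu := (@lebesgue_measure R).

(** The rate 1/2 is a compromise: 1 / sinh t decays like exp (- t), and half of that decay is spent
    on absorbing powers of t. *)
Definition exp_dominated h :=
  exists C, forall t, 0 <= t -> `|h t| <= C * expR (- 2^-1 * t).

Lemma exp_dominated_pos h C :
  (forall t, 0 < t -> `|h t| <= C * expR (- 2^-1 * t)) -> exp_dominated h.
Proof.
move=> hC; exists (`|C| + `|h 0|) => t; rewrite le_eqVlt => /predU1P[<-|t0].
  by rewrite mulr0 expR0 mulr1 lerDr.
apply: le_trans (hC t t0) _; rewrite ler_wpM2r ?expR_ge0//.
by rewrite (le_trans (ler_norm C))// lerDl.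
Qed.

Lemma is_derive_exp_half C t :
  is_derive t 1 (fun t => - 2 * C * expR (- 2^-1 * t)) (C * expR (- 2^-1 * t)).
Proof.
apply: (is_derive_val (is_deriveZx _ (is_derive_expZ _ _))).
by field.
Qed.

Lemma cvg_exp_half C :
  (- 2 * C * expR (- 2^-1 * t) @[t --> +oo] --> (0 : R))%classic.
Proof.
suff h : (expR (- 2^-1 * t) @[t --> +oo] --> (0 : R))%classic.
  have E : (- 2 * C * expR (- 2^-1 * t) @[t --> +oo] -->
      (- 2 * C * 0 : R))%classic by apply: cvgMr; exact: h.
  by rewrite mulr0 in E.
have : ((fun t : R => 2^-1 * t) t @[t --> +oo] --> +oo)%classic.
  apply/cvgryPge => A; near=> t.
  have : 2 * A <= t by near: t; apply: nbhs_pinfty_ge; exact: num_real.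
  by move=> ?; lra.
move=> h; rewrite (_ : (fun t => _) = fun t => expR (- (2^-1 * t))); last first.
  by apply/funext => t; rewrite mulNr.
exact: (cvg_comp (fun t : R => 2^-1 * t) (fun t : R => expR (- t)) h (@cvgr_expR R)).
Unshelve. all: end_near. Qed.

Lemma continuous_exp_half C : continuous (fun t : R => C * expR (- 2^-1 * t)).
Proof.
move=> t; exact: (is_derive_continuous (is_deriveZx C (is_derive_expZ _ t))).
Qed.

Lemma continuous_measurable_itv h (i : interval R) : continuous h ->
  measurable_fun [set` i] h.
Proof.
by move=> ch; apply: measurable_funTS; exact: continuous_measurable_fun.
Qed.

Lemma ge0_integral_derive f h l : (forall t, is_derive t 1 f (h t)) ->
  continuous h -> (forall t, 0 <= t -> 0 <= h t) ->
  (f t @[t --> +oo] --> l)%classic ->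
  (\int[mu]_(t in `[0%R, +oo[) (h t)%:E = l%:E - (f 0)%:E)%E.
Proof.
move=> df ch h0 fl; apply: ge0_continuous_FTC2y => //.
- exact: continuous_subspaceT.
- by apply: cvg_at_right_filter; exact: is_derive_continuous (df 0).
- by move=> t _; rewrite derive1E; case: (df t).
Qed.

Lemma integrable_exp_half C : 0 <= C ->
  mu.-integrable `[0, +oo[ (EFin \o (fun t => C * expR (- 2^-1 * t))).
Proof.
move=> C0; apply/integrableP; split.
  by apply/measurable_EFinP; apply: continuous_measurable_itv;
    exact: continuous_exp_half.
rewrite (_ : (\int[mu]_(x in _) _ =
   \int[mu]_(t in `[0%R, +oo[) (C * expR (- 2^-1 * t))%:E)%E); last first.
  apply: eq_integral => t _ /=.
  by rewrite ger0_norm// mulr_ge0// expR_ge0.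
rewrite (ge0_integral_derive (is_derive_exp_half C) _ _ (cvg_exp_half C)).
- by rewrite -EFinB ltry.
- exact: continuous_exp_half.
- by move=> t _; rewrite mulr_ge0// expR_ge0.
Qed.

Lemma exp_dominated_integrable h : continuous h -> exp_dominated h ->
  mu.-integrable `[0, +oo[ (EFin \o h).
Proof.
move=> ch [C hC].
have := integrable_exp_half (normr_ge0 C); apply: le_integrable => //.
  by apply/measurable_EFinP; exact: continuous_measurable_itv.
move=> t /=; rewrite in_itv /= andbT => t0; rewrite lee_fin.
apply: le_trans (hC t t0) _; rewrite [leRHS]ger0_norm ?mulr_ge0 ?expR_ge0//.
by rewrite ler_wpM2r ?expR_ge0// ler_norm.
Qed.

(** A signed [h] is handled by adding its dominating function [k], whose antiderivative [K] is
    explicit: the nonnegative case applies to h + k and to k, and the results are subtracted. *)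
Lemma Rintegral_derive f h l : (forall t, is_derive t 1 f (h t)) ->
  continuous h -> exp_dominated h -> (f t @[t --> +oo] --> l)%classic ->
  \int[mu]_(t in `[0, +oo[) h t = l - f 0.
Proof.
move=> df ch hd fl; have [C hC] := hd.
pose k t : R := `|C| * expR (- 2^-1 * t).
pose K t : R := - 2 * `|C| * expR (- 2^-1 * t).
have ck : continuous k by exact: continuous_exp_half.
have k0 t : 0 <= k t by rewrite mulr_ge0// expR_ge0.
have ih := exp_dominated_integrable ch hd.
have ik := integrable_exp_half (normr_ge0 C).
have Ek : \int[mu]_(t in `[0, +oo[) k t = 0 - K 0.
  by rewrite /Rintegral (ge0_integral_derive (is_derive_exp_half _) ck _
    (cvg_exp_half _)).
have Ehk : \int[mu]_(t in `[0, +oo[) (h t + k t) = l + 0 - (f 0 + K 0).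
  have dfk t : is_derive t 1 (fun t => f t + K t) (h t + k t).
    exact: is_deriveDx (df t) (is_derive_exp_half _ t).
  rewrite /Rintegral (ge0_integral_derive dfk (l := l + 0))//.
  - by move=> t; apply: continuousD; [exact: ch|exact: ck].
  - move=> t t0; rewrite -lerBlDr sub0r.
    have := hC t t0; rewrite ler_norml => /andP[+ _]; apply: le_trans.
    by rewrite lerN2 ler_wpM2r ?expR_ge0// ler_norm.
  - by apply: cvgD => //; exact: cvg_exp_half.
rewrite RintegralD// Ek in Ehk.
by apply: (addIr (0 - K 0)); rewrite Ehk; ring.
Qed.

(** The function f + 2 C exp (- t / 2) has derivative h - C exp (- t / 2) <= 0. This gives upper
    bounds and rates for [f] without integrating. *)
Lemma derive_exp_le f h C : (forall t, is_derive t 1 f (h t)) ->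
  (forall t, 0 <= t -> h t <= C * expR (- 2^-1 * t)) ->
  forall t u, 0 <= t -> t <= u -> f u + 2 * C * expR (- 2^-1 * u) <=
                                  f t + 2 * C * expR (- 2^-1 * t).
Proof.
move=> df hC t u t0 tu.
pose g t : R := f t - (- 2 * C * expR (- 2^-1 * t)).
have dg (x : R) : is_derive x 1 g (h x - C * expR (- 2^-1 * x)).
  exact: is_deriveBx (df x) (is_derive_exp_half C x).
suff : g u <= g t by rewrite /g !mulNr !opprK.
apply: (@ler0_derive1_le_cc _ g t u _ _ _ u t) => //.
- move=> x; rewrite in_itv/= => /andP[tx _].
  rewrite derive1E; case: (dg x) => _ ->; rewrite subr_le0 hC//.
  by rewrite (le_trans t0)// ltW.
- by apply: continuous_subspaceT => x; exact: is_derive_continuous (dg x).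
- by rewrite in_itv/= tu lexx.
- by rewrite in_itv/= tu lexx.
Qed.

Lemma derive_ge0_le f h : (forall t, is_derive t 1 f (h t)) ->
  (forall t, 0 <= t -> 0 <= h t) ->
  forall t u, 0 <= t -> t <= u -> f t <= f u.
Proof.
move=> df h0 t u t0 tu.
have := @derive_exp_le (fun x => - f x) (fun x => - h x) 0 _ _ t u t0 tu.
rewrite !(mulr0, mul0r, addr0) lerN2; apply=> x x0.
by rewrite mul0r oppr_le0 h0.
Qed.

(** The k-th power of y <= exp y at y = t / (2 k); for k = 0 the constant is 0^0 = 1. *)
Lemma exprn_le_expR k t : 0 <= t ->
  t ^+ k <= (2 * k%:R) ^+ k * expR (2^-1 * t).
Proof.
case: k => [|k] t0.
  rewrite !expr0 mul1r; apply: le_trans (expR_ge1Dx _).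
  by rewrite lerDl mulr_ge0.
have k0 : 0 < 2 * k.+1%:R :> R by rewrite mulr_gt0.
have -> : expR (2^-1 * t) = expR (t / (2 * k.+1%:R)) ^+ k.+1.
  rewrite -expRM_natl; congr expR; field.
  by rewrite -natr1 in k0 *; rewrite gt_eqF//; lra.
rewrite -exprMn lerXn2r ?nnegrE ?mulr_ge0 ?expR_ge0 ?(ltW k0)//.
rewrite mulrC -ler_pdivrMr//.
by apply: le_trans (expR_ge1Dx _); rewrite lerDr.
Qed.

Lemma exprn_sinh_le n : exists C, forall t, 0 < t ->
  t ^+ n.+1 / Defs.sinh t <= C * expR (- 2^-1 * t).
Proof.
exists ((2 * n%:R) ^+ n + 2 * (2 * n.+1%:R) ^+ n.+1) => t t0.
have st := sinh_gt0 t0.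
rewrite ler_pdivrMr//.
(* Equivalent to 1 + 2 t <= exp (2 t). It yields t / sinh t <= (1 + 2 t) exp (- t), which cancels
   the pole at 0 and keeps the full decay; the two summands of the witness bound t^n and 2
   t^(n+1). *)
have h : t * expR t <= (1 + 2 * t) * Defs.sinh t.
  have e2 : 1 + 2 * t <= expR t ^+ 2.
    by rewrite -expRM_natl; exact: expR_ge1Dx.
  have uv := expR_mulN t; have u0 := expR_gt0 t; have v0 := expR_gt0 (- t).
  have : expR (- t) * (1 + 2 * t) <= expR (- t) * expR t ^+ 2.
    by rewrite ler_wpM2l// ltW.
  rewrite (_ : _ * expR t ^+ 2 = expR t * expR (- t) * expR t); last by ring.
  rewrite uv mul1r /Defs.sinh => ?; lra.
have p1 := exprn_le_expR n (ltW t0).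
have p2 := exprn_le_expR n.+1 (ltW t0).
have e : expR (- 2^-1 * t) = expR (2^-1 * t) * expR (- t).
  by rewrite -expRD; congr expR; field.
set C := _ + _.
have h2 : t ^+ n * (1 + 2 * t) <= C * expR (2^-1 * t).
  by rewrite mulrDr mulr1 mulrCA -exprSr /C [leRHS]mulrDl lerD// -mulrA ler_wpM2l.
have : t ^+ n * expR (- t) * (t * expR t) <=
       t ^+ n * expR (- t) * ((1 + 2 * t) * Defs.sinh t).
  by rewrite ler_wpM2l// mulr_ge0 ?expR_ge0 ?exprn_ge0// ltW.
rewrite (_ : _ * (t * expR t) = t ^+ n.+1 * (expR t * expR (- t))); last first.
  by rewrite exprS; ring.
rewrite expR_mulN mulr1 => /le_trans; apply.
rewrite e (_ : _ * _ * _ = t ^+ n * (1 + 2 * t) * (expR (- t) * Defs.sinh t));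
  last by ring.
rewrite (_ : C * _ * _ = C * expR (2^-1 * t) * (expR (- t) * Defs.sinh t));
  last by ring.
by rewrite ler_wpM2r// mulr_ge0 ?expR_ge0// ltW.
Qed.

End Integrals.

(** * Behaviour at t -> +oo: limits, rates and the logarithmic divergence *)

Section Asymptotics.
Context {R : realType}.
Implicit Types (c : nat -> R) (s a : seq nat) (t x : R).

Local Notation th t := (Defs.tanh (t / 2)).

Definition polyT s : R := limn (series (coef s)).

(** Both factors are bounded by powers of t, and the nonempty second index contributes at least one
    power, enough to offset the pole of 1 / sinh t. *)
Lemma polyA_mul_dominated s m s' : all (leq 1) s -> all (leq 1) (m :: s') ->
  exp_dominated (fun t => polyA s t * polyA_sinh (m :: s') t : R).
Proof.
move=> s1 s1'; have [C hC] := @exprn_sinh_le R (size s + size s')%N.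
apply: (@exp_dominated_pos _ _ C) => t t0.
have t0' := ltW t0; have sh := sinh_gt0 t0.
rewrite ger0_norm; last first.
  exact: mulr_ge0 (polyA_ge0 _ t0') (polyA_sinh_ge0 _ _ t0').
rewrite polyA_sinhE// mulrA; apply: le_trans (hC t t0).
rewrite ler_wpM2r ?invr_ge0 ?(ltW sh)//.
rewrite -addnS exprD ler_pM ?polyA_ge0//.
- apply: le_trans (polyA_le s1 t0') _.
  by rewrite ler_piMr ?exprn_ge0// invf_le1 ?ltr0n ?ler1n fact_gt0.
- apply: le_trans (polyA_le s1' t0') _.
  by rewrite ler_piMr ?exprn_ge0// invf_le1 ?ltr0n ?ler1n fact_gt0.
Qed.

Lemma polyA_sinh_dominated m s : all (leq 1) (m :: s) ->
  exp_dominated (polyA_sinh (m :: s) : R -> R).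
Proof.
move=> s1; have := @polyA_mul_dominated [::] m s isT s1.
by move=> [C hC]; exists C => t t0; have := hC t t0; rewrite polyA_nil mul1r.
Qed.

Section Admissible.
Variables (m : nat) (s : seq nat).
Hypothesis s1 : all (leq 1) s.
Let a := m.+2 :: s.

Let polyA_rate : exists2 C : R, 0 <= C &
  forall t, 0 <= t -> polyA_sinh (m.+1 :: s) t <= C * expR (- 2^-1 * t).
Proof.
have [|C hC] := @polyA_sinh_dominated m.+1 s; first by rewrite /= s1.
exists `|C| => // t t0; apply: le_trans (ler_norm _) _.
by apply: le_trans (hC t t0) _; rewrite ler_wpM2r ?expR_ge0// ler_norm.
Qed.

(** Convergence of T(a) is read off the generating function: its t-derivative is exponentially
    dominated, so it stays below 2 C, and nonnegative coefficients turn this bound into convergence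
    at z = 1. *)
Lemma admissible_cvg : cvgn (series (coef a : nat -> R)).
Proof.
have [C C0 hC] := polyA_rate.
apply: (@bounded_psum_th _ _ (2 * C)); first exact: summable_coef.
move=> t t0; have := derive_exp_le (is_derive_polyA m.+1 s) hC (lexx 0) t0.
rewrite polyA_at0 mulr0 expR0 add0r mulr1; apply: le_trans.
by rewrite lerDl !mulr_ge0// expR_ge0.
Qed.

Lemma polyA_cvg : (polyA a t @[t --> +oo] --> polyT a)%classic.
Proof. exact: psum_th_cvg (summable_coef _) admissible_cvg. Qed.

Lemma polyA_le_polyT t : 0 <= t -> polyA a t <= polyT a.
Proof.
move=> t0; apply: (cvgr_to_ge polyA_cvg); near=> u.
apply: (derive_ge0_le (is_derive_polyA m.+1 s)) => //.
by move=> x x0; exact: polyA_sinh_ge0.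
Unshelve. all: end_near. Qed.

Lemma polyT_ge0 : 0 <= polyT a.
Proof. by apply: le_trans (polyA_le_polyT (lexx 0)); rewrite polyA_at0. Qed.

Lemma polyA_tail : exists2 C : R, 0 <= C &
  forall t, 0 <= t -> polyT a - polyA a t <= C * expR (- 2^-1 * t).
Proof.
have [C C0 hC] := polyA_rate; exists (2 * C); first by rewrite mulr_ge0.
move=> t t0; rewrite lerBlDl.
apply: (cvgr_to_le polyA_cvg); near=> u.
have tu : t <= u by near: u; apply: nbhs_pinfty_ge; exact: num_real.
apply: le_trans (derive_exp_le (is_derive_polyA m.+1 s) hC t0 tu).
by rewrite lerDl !mulr_ge0// expR_ge0.
Unshelve. all: end_near. Qed.

Lemma mul_polyA_tail_cvg0 :
  ((polyT a - polyA a t) * t @[t --> +oo] --> (0 : R))%classic.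
Proof.
have [C C0 hC] := polyA_tail.
apply/cvgrPdist_le => e e0; near=> t.
have t1 : 1 <= t by near: t; exact: nbhs_pinfty_ge.
(* By [exprn_le_expR] with k = 2, t^2 exp (- t / 2) <= (2 * 2)^2 = 16, so the quantity to bound is
   at most 16 C / t. *)
have t2 : C * 16 / e <= t.
  by near: t; apply: nbhs_pinfty_ge; exact: num_real.
have t0 : 0 <= t by exact: le_trans t1.
rewrite sub0r normrN ger0_norm; last first.
  by rewrite mulr_ge0// subr_ge0 polyA_le_polyT.
have p := exprn_le_expR 2 t0.
have p' : t ^+ 2 * expR (- 2^-1 * t) <= 16.
  have : t ^+ 2 * expR (- 2^-1 * t) <=
         ((2 * 2%:R) ^+ 2 * expR (2^-1 * t)) * expR (- 2^-1 * t).
    by rewrite ler_wpM2r ?expR_ge0.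
  by rewrite -mulrA mulNr expR_mulN; lra.
have t0' : 0 < t by exact: lt_le_trans t1.
rewrite -(ler_pM2l t0'); apply: (@le_trans _ _ (C * 16)); last first.
  by move: t2; rewrite ler_pdivrMr.
have h : (polyT a - polyA a t) * t ^+ 2 <= C * expR (- 2^-1 * t) * t ^+ 2.
  by rewrite ler_wpM2r ?exprn_ge0// hC.
rewrite (_ : t * _ = (polyT a - polyA a t) * t ^+ 2); last by ring.
apply: le_trans h _; rewrite -mulrA [expR _ * _]mulrC.
by rewrite ler_wpM2l.
Unshelve. all: end_near. Qed.

(** The t-derivative of the left side is T(a) - A(a), which is exponentially small. Boundedness
    alone is what the Tauberian step for the convoluted series asks for. *)
Lemma polyA1_linear_le : exists M, forall t, 0 <= t ->
  polyT a * t - polyA (1%N :: a) t <= M.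
Proof.
have [C C0 hC] := polyA_tail; exists (2 * C) => t t0.
pose f t : R := polyT a * id t - polyA (1%N :: a) t.
have df x : is_derive x 1 f (polyT a - polyA a x).
  apply: (is_derive_val (is_deriveBx (is_deriveZx _ (is_derive_id _ _))
    (is_derive_polyA1 _ _))).
  by rewrite mulr1.
have := derive_exp_le df hC (lexx 0) t0.
rewrite /f /= polyA_at0 !mulr0 expR0 subr0 add0r mulr1; apply: le_trans.
by rewrite lerDl !mulr_ge0// expR_ge0.
Qed.

End Admissible.

(* Coefficients of the logarithmic divergence of [polyA (1 :: a)]: for [b] the
   parity of its depth, [log ((1 + z) / (1 - z))] or [- log (1 - z ^ 2)]. *)
Definition harm_coef b : nat -> R := coef_step 1 b (coef [::]).

Lemma summable_harm_coef b : summable_in (harm_coef b).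
Proof. by apply: summable_coef_step; exact: summable_coef. Qed.

Lemma series_coef_nil n : series (coef [::]) n.+1 = 1 :> R.
Proof.
rewrite seriesEnat /= big_nat_recl//= big1 ?addr0// => i _.
Qed.

Lemma harm_coefE b n : harm_coef b n = if odd n == b then 2 / n%:R else 0.
Proof.
rewrite /harm_coef /coef_step; case: n => [|n].
  by rewrite seriesEnat /= big_geq// mulr0 mul0r invr0 mulr0.
by rewrite series_coef_nil mulr1 expr1.
Qed.

Lemma psum_harm_coef_true t : psum (harm_coef true) (th t) = t.
Proof. by have := polyA_nseq1 1 t; rewrite expr1 divr1. Qed.

Lemma is_derive_harm_coef_false t :
  is_derive t 1 (fun t => psum (harm_coef false) (th t)) (th t).
Proof.
apply: (is_derive_val (is_derive_psum_th t (summable_harm_coef _))).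
have h := psum_diffs_coef_step1 false (summable_coef [::]) (th_lt1 t).
have e : psum (fun n => coef_step 0 false (coef [::]) n.+1 -
    shift (coef_step 0 false (coef [::])) n) (th t) = 2 * th t.
  transitivity (psum (shift (fun n => 2 * coef [::] n)) (th t)).
    have S n : series (fun n => (n == 0%N)%:R) n.+1 = 1 :> R.
      exact: series_coef_nil.
    apply: eq_psum => -[|[|n]] /=; rewrite /coef_step /= ?subr0//.
      by rewrite S series_0 !expr0 !divr1 mulr0 subr0.
    by rewrite !negbK !S !expr0 subrr mulr0.
  have s2 := summable_inZ (ler0n R 2) (summable_coef [::]).
  rewrite psum_shift; last exact: summable_in_cvg s2 (th_lt1 t).
  rewrite mulrC; congr (_ * _).
  apply: cvg_lim => //; rewrite -cvg_shiftS.
  rewrite (_ : [sequence _]_n = fun=> 2); first exact: cvg_cst.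
  apply/funext => n; rewrite /pseries seriesEnat /= big_nat_recl//=.
  by rewrite expr0 !mulr1 big1 ?addr0// => i _; rewrite mulr0 mul0r.
rewrite /harm_coef mulrA mulrC [_ * (1 - _)]mulrC h e mulKf//.
Qed.

(** This is - log (1 - z^2) = 2 log cosh (t / 2), and cosh (t / 2) = exp (t / 2) (1 + exp (- t)) /
    2. The halving is the origin of every log 2 in the theorem. Both sides vanish at t = 0 and have
    derivative z. *)
Lemma psum_harm_coef_false t :
  psum (harm_coef false) (th t) = t + 2 * ln (1 + expR (- t)) - 2 * ln 2.
Proof.
pose f t : R := psum (harm_coef false) (th t) -
  (id t + 2 * ln (cst 1 t + expR (- 1 * t))).
have f' x : is_derive x 1 f 0.
  have e0 : 0 < 1 + expR (-1 * x) by rewrite addr_gt0// expR_gt0.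
  apply: (is_derive_val (is_deriveBx (is_derive_harm_coef_false x)
    (is_deriveDx (is_derive_id x 1) (is_deriveZx 2 (is_derive_compx
      (g := fun x => cst 1 x + expR (- 1 * x))
      (is_derive1_ln e0) (is_deriveDx (is_derive_cst (1 : R) x 1)
        (is_derive_expZ _ _))))))).
  rewrite thE mulN1r in e0 *.
  have -> : - x = - (x / 2) + - (x / 2) by rewrite -opprD -splitr.
  rewrite expRD /=.
  have := expR_mulN (x / 2); have := cosh_neq0 x; have := expR_gt0 (- (x / 2)).
  set u := expR (x / 2); set v := expR (- (x / 2)) => v0 uv0 uv.
  have v1 : v != 0 by rewrite gt_eqF.
  have -> : 1 + v * v = (u + v) * v by rewrite mulrDl uv.
  by field; rewrite uv0 v1.
have := is_derive_0_is_cst t 0 f'; rewrite /f /= th0 psum0 harm_coefE /=.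
rewrite !mulr0 invr0 mulr0 sub0r add0r expR0 mulN1r => /eqP.
by rewrite subr_eq => /eqP ->; rewrite addrC.
Qed.

Lemma harm_coef_cvg b : (t - psum (harm_coef b) (th t) @[t --> +oo] -->
  (if b then 0 else 2 * ln 2 : R))%classic.
Proof.
case: b.
  by under eq_fun do rewrite psum_harm_coef_true subrr; exact: cvg_cst.
rewrite (_ : (fun t => _) = fun t => 2 * ln 2 - 2 * ln (1 + expR (- t)));
  last by apply/funext => t; rewrite psum_harm_coef_false; ring.
have h : (1 + expR (- t) @[t --> +oo] --> (1 + 0 : R))%classic.
  by apply: cvgD; [exact: cvg_cst|exact: cvgr_expR].
rewrite addr0 in h.
have hl : (ln (1 + expR (- t)) @[t --> +oo] --> (ln 1 : R))%classic.
  by apply: (cvg_comp _ (@ln R) h); apply: continuous_ln; exact: ltr01.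
have E : (2 * ln 2 - 2 * ln (1 + expR (- t)) @[t --> +oo] -->
    (2 * ln 2 - 2 * ln 1 : R))%classic.
  by apply: cvgB; [exact: cvg_cst|apply: cvgMr; exact: hl].
by rewrite ln1 mulr0 subr0 in E.
Qed.

Lemma psum_harm_coef_le b t : 0 <= t -> psum (harm_coef b) (th t) <= t.
Proof.
case: b => t0; first by rewrite psum_harm_coef_true.
rewrite psum_harm_coef_false -addrA gerDl subr_le0.
have e0 : 0 < 1 + expR (- t) by rewrite addr_gt0// expR_gt0.
rewrite ler_wpM2l// ler_ln ?posrE//.
have : expR (- t) <= expR 0 by rewrite ler_expR oppr_le0.
by rewrite expR0; lra.
Qed.

End Asymptotics.

(** * The convoluted value as the constant term of A(a, 1) at infinity *)

Section ConvolutedValues.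
Context {R : realType}.
Variables (m : nat) (s : seq nat).
Hypothesis s1 : all (leq 1) s.
Let a := m.+2 :: s.
Let b := ~~ odd (size a).

Local Notation th t := (Defs.tanh (t / 2)).
Local Notation H := (series (harm_coef b : nat -> R)).
Local Notation ca := (coef a : nat -> R).
Let T : R := polyT a.

(** Since [coef (1 :: a) n] is [harm_coef b n * series ca n], the coefficients of T(a) L(z) - A(a,
    1; z) are [harm_coef b n * tail n]. At z = 1, exchanging the double sum turns their total into
    the sum of [convo]; there [H n.+1] includes the index [n] itself. *)
Let tail n : R := T - series ca n.
Let convo n : R := ca n * H n.+1.

Let tailS n : tail n = ca n + tail n.+1.
Proof. by rewrite /tail seriesSr; ring. Qed.

Let tail_ge0 n : 0 <= tail n.
Proof.
rewrite subr_ge0; apply: nondecreasing_cvgn_le; last exact: admissible_cvg.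
by apply: (@nondecreasing_series _ _ predT) => i _ _; exact: coef_ge0.
Qed.

Let harm_ge0 n : 0 <= harm_coef b n :> R.
Proof. exact: coef_step_ge0 (coef_ge0 [::]) n. Qed.

Let H_ge0 n : 0 <= H n.
Proof. by rewrite seriesEnat /= sumr_ge0. Qed.

Let H_nd : nondecreasing_seq H.
Proof. by apply: (@nondecreasing_series _ _ predT) => i _ _. Qed.

Let convo_ge0 n : 0 <= convo n.
Proof. by rewrite mulr_ge0// coef_ge0. Qed.

(** Finite form of the exchange of the double sum; [tail N * H N] collects the pairs whose
    [harm_coef] index is below [N] and whose [ca] index is not. *)
Let summation_by_parts N :
  series (fun n => harm_coef b n * tail n) N = series convo N + tail N * H N.
Proof.
elim: N => [|N IH]; first by rewrite !seriesEnat /= !big_geq// mulr0 addr0.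
by rewrite !seriesSr IH (tailS N) /convo seriesSr; ring.
Qed.

Let T0 : 0 <= T. Proof. exact: polyT_ge0. Qed.

Let summable_rest : summable_in (fun n => harm_coef b n * tail n).
Proof.
have := summable_inZ T0 (summable_harm_coef b); apply: le_summable_in => n.
rewrite mulr_ge0//= [leRHS]mulrC ler_wpM2l// /tail gerBl.
by rewrite seriesEnat /=; apply: sumr_ge0 => i _; exact: (coef_ge0 a i).
Qed.

Let psum_rest t : psum (fun n => harm_coef b n * tail n) (th t) =
  T * psum (harm_coef b) (th t) - polyA (1%N :: a) t.
Proof.
have cv1 := summable_in_cvg (summable_inZ T0 (summable_harm_coef b)) (th_lt1 t).
have cv2 := summable_in_cvg (summable_coef (1%N :: a)) (th_lt1 t).
have -> : T * psum (harm_coef b) (th t) =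
    psum (fun n => T * harm_coef b n) (th t).
  apply/esym/cvg_lim => //.
  rewrite (_ : pseries _ _ = fun n => T * pseries (harm_coef b) (th t) n).
    by apply: cvgMr; exact: summable_in_cvg (summable_harm_coef b) (th_lt1 t).
  apply/funext => n; rewrite /pseries !seriesEnat /= mulr_sumr.
  by apply: eq_bigr => i _; rewrite mulrA.
rewrite /polyA -psumB//; apply: eq_psum => n.
rewrite /tail mulrBr [T * _]mulrC; congr (_ - _).
rewrite coef_cons harm_coefE /coef_step -/b; case: ifP => _; last by rewrite mul0r.
by rewrite expr1 mulrAC.
Qed.

Let rest_cvg : cvgn (series (fun n => harm_coef b n * tail n)).
Proof.
have [M hM] := @polyA1_linear_le R m s s1.
apply: (@bounded_psum_th _ _ M); first exact: summable_rest.
move=> t t0; rewrite psum_rest; apply: le_trans (hM t t0).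
by rewrite lerB// ler_wpM2l// psum_harm_coef_le.
Qed.

Let convo_cvg : cvgn (series convo).
Proof.
apply: nondecreasing_is_cvgn.
  by apply: (@nondecreasing_series _ _ predT) => i _ _.
exists (limn (series (fun n => harm_coef b n * tail n))) => _ [n _ <-].
apply: (@le_trans _ _ (series (fun n => harm_coef b n * tail n) n)).
  by rewrite summation_by_parts lerDl mulr_ge0.
apply: nondecreasing_cvgn_le => //.
apply: (@nondecreasing_series _ _ predT) => i _ _.
by rewrite mulr_ge0.
Qed.

(** As [H] is nondecreasing, replacing H_N by H_(i+1) for each i >= N only increases the sum. The
    boundary term is thus squeezed by the remainder of a convergent series. *)
Let tail_mul_H_le N : tail N * H N <= limn (series convo) - series convo N.
Proof.
have h : ((series ca M - series ca N) * H N @[M --> \oo] -->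
    (tail N * H N : R))%classic.
  apply: cvgMl; apply: cvgB; last exact: cvg_cst.
  exact: admissible_cvg.
apply: (cvgr_to_le h); near=> M.
have NM : (N <= M)%N by near: M; exact: nbhs_infty_ge.
apply: (@le_trans _ _ (series convo M - series convo N)); last first.
  rewrite lerB// nondecreasing_cvgn_le//.
  by apply: (@nondecreasing_series _ _ predT) => i _ _.
rewrite !sub_series_geq// mulr_suml; apply: ler_sum_nat => i /andP[Ni _].
by rewrite ler_wpM2l ?coef_ge0// H_nd// leqW.
Unshelve. all: end_near. Qed.

Let limn_rest : limn (series (fun n => harm_coef b n * tail n)) =
  limn (series convo).
Proof.
apply: cvg_lim => //.
have h0 : (tail N * H N @[N --> \oo] --> (0 : R))%classic.
  have e0 : (limn (series convo) - series convo N @[N --> \oo] --> (0 : R))%classic.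
    rewrite -(subrr (limn (series convo))).
    by apply: cvgB; [exact: cvg_cst|exact: convo_cvg].
  have e1 : ((fun _ : nat => 0 : R) N @[N --> \oo] --> (0 : R))%classic.
    exact: cvg_cst.
  apply: squeeze_cvgr e1 e0; apply: nearW => N.
  by rewrite tail_mul_H_le mulr_ge0.
rewrite (_ : series (fun n => harm_coef b n * tail n) =
    fun N => series convo N + tail N * H N).
  by rewrite -[X in (_ --> X)%classic]addr0; apply: cvgD.
by apply/funext => N; exact: summation_by_parts.
Qed.

Lemma polyA1_asymptotic :
  (polyT a * t - polyA (1%N :: a) t @[t --> +oo] -->
   limn (series (fun n => coef a n * series (harm_coef (~~ odd (size a))) n.+1)) +
   (if odd (size a) then 2 * ln 2 * polyT a else 0 : R))%classic.
Proof.
rewrite -/b -/convo -limn_rest.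
(* Writing T t = T L + T (t - L), Abel's theorem handles T L - A(a, 1), and t - L tends to 0 or to 2
   log 2 according to the parity. *)
rewrite (_ : (fun t => _) = fun t => psum (fun n => harm_coef b n * tail n) (th t)
   + T * (t - psum (harm_coef b) (th t))); last first.
  by apply/funext => t; rewrite psum_rest /T; ring.
apply: cvgD; first exact: psum_th_cvg summable_rest rest_cvg.
have E : (T * (t - psum (harm_coef b) (th t)) @[t --> +oo] -->
    (T * (if b then 0 else 2 * ln 2) : R))%classic.
  by apply: cvgMr; exact: harm_coef_cvg.
suff -> : (if odd (size a) then 2 * ln 2 * polyT a else 0) =
          T * (if b then 0 else 2 * ln 2) by exact: E.
by rewrite /b; case: (odd (size a)); rewrite /= ?mulr0// mulrC.
Qed.

Let series_double2 (c : nat -> R) n :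
  series c n.+1.*2 = series c n.*2 + c n.*2 + c n.*2.+1.
Proof. by rewrite doubleS 2!seriesSr. Qed.

Let harmS1E n : harmS1 R n.+1 = series (harm_coef false) n.+1.*2.
Proof.
elim: n => [|n IH].
  rewrite /harmS1 big_geq// series_double2 series_0 !harm_coefE /=.
  by rewrite invr0 mulr0 !addr0.
rewrite /harmS1 big_nat_recr//= -/(harmS1 R n.+1) IH [RHS]series_double2.
rewrite !harm_coefE oddS odd_double eqxx addr0; congr (_ + _).
by rewrite -mul2n natrM.
Qed.

Let harmT1E n : (0 < n)%N -> harmT R [:: 1%N] n = series (harm_coef true) n.*2.
Proof. by move=> n0; rewrite harmT_coef. Qed.

Let take_size_rcons (c : seq nat) x : take (size c) (rcons c x) = c.
Proof. by rewrite -cats1 take_size_cat. Qed.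

(** Only one parity class of indices contributes to [convo]: 2 n - 1 or 2 n, so cutting at 2 N + 1
    keeps exactly n <= N. The outer 2 is the one in [coef_step], and m + 2 is the lowered exponent m
    + 1 plus the 1 of the convolution. *)
Let convT11E N : 2 * (\sum_(1 <= n < N.+1)
  if odd (size a)
  then harmT R (rev s) n * harmS1 R n / (2 * n%:R - 1) ^+ m.+2
  else harmT R (rev s) n * harmT R [:: 1%N] n / (2 * n%:R) ^+ m.+2) =
  series convo N.*2.+1.
Proof.
have convo0 k : odd k != odd (size a) -> convo k = 0.
  by move=> ok; rewrite /convo coef_parity ?mul0r.
have cs0 k : odd k != odd (size s) -> coef s k = 0 :> R by exact: coef_parity.
elim: N => [|N IH].
  by rewrite big_geq// mulr0 seriesSr series_0 add0r /convo coef0 mul0r.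
rewrite big_nat_recr//= mulrDr IH doubleS [RHS]seriesSr [in RHS]seriesSr -addrA.
congr (_ + _); rewrite harmT_coef// revK.
have oa : odd (size a) = ~~ odd (size s) by [].
case: ifPn => os.
- rewrite [X in _ = _ + X]convo0; last by rewrite oa /= odd_double os.
  rewrite addr0 /convo coef_cons /coef_step !oddS odd_double os /=.
  (* [harmT_coef] sums up to index 2 N + 1, one more than [coef_step] does; the extra term has the
     wrong parity and vanishes. *)
  rewrite doubleS seriesSr cs0 ?oddS ?odd_double; last by case: (odd (size s)) os.
  rewrite addr0 harmS1E doubleS.
  have -> : b = false by rewrite /b oa os.
  have -> : 2 * N.+1%:R - 1 = N.*2.+1%:R :> R.
    by rewrite -!natr1 -muln2 natrM; ring.
  by ring.
- rewrite convo0; last by rewrite oa oddS odd_double; case: (odd (size s)) os.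
  rewrite add0r /convo coef_cons /coef_step -doubleS odd_double oddS (negPf os) eqxx.
  have -> : b = true by rewrite /b oa; case: (odd (size s)) os.
  rewrite [series (harm_coef _) _]seriesSr harm_coefE odd_double /= addr0 harmT1E//.
  have -> : 2 * N.+1%:R = N.+1.*2%:R :> R by rewrite -mul2n natrM.
  by ring.
Qed.

Lemma convT11_coef : convT11 R (decr_last (rev a)) =
  limn (series (fun n => coef a n * series (harm_coef (~~ odd (size a))) n.+1)).
Proof.
have -> : decr_last (rev a) = rcons (rev s) m.+1.
  by rewrite /decr_last rev_cons size_rcons last_rcons /= take_size_rcons.
rewrite /convT11 size_rcons last_rcons /= take_size_rcons size_rev -/b -/convo.
have sub : (k.*2.+1 @[k --> \oo] --> \oo)%classic.
  apply/cvgnyPge => A; near=> k.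
  have : (A <= k)%N by near: k; exact: nbhs_infty_ge.
  by move=> Ak; rewrite (leq_trans Ak)// -addnn leqW// leq_addr.
have D := cvgMr (a := 2^-1) (cvg_comp _ _ sub convo_cvg).
have E N := congr1 (fun x => 2^-1 * x) (convT11E N).
have two : 2 != 0 :> R by rewrite pnatr_eq0.
have -> : limn (series convo) = 2 * (2^-1 * limn (series convo)).
  by rewrite mulVKf.
case: ifPn => os; congr (2 * _); apply: cvg_lim => //.
- rewrite (_ : (fun N => _) = fun N => 2^-1 * series convo N.*2.+1).
    exact: D.
  apply/funext => N; have := E N; rewrite mulKf// => <-.
  by apply: eq_bigr => n _; rewrite /= os.
- rewrite (_ : (fun N => _) = fun N => 2^-1 * series convo N.*2.+1).
    exact: D.
  apply/funext => N; have := E N; rewrite mulKf// => <-.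
  by apply: eq_bigr => n _; rewrite /= (negPf os).
Unshelve. all: end_near. Qed.

End ConvolutedValues.

(** * Integration by parts for integrals of products *)

Section IntegralsOfProducts.
Context {R : realType}.
Implicit Types (s u : seq nat) (t : R).

Local Notation mu := (@lebesgue_measure R).

(* The integral of [A(s; z) A(u; z) / z] over (0, 1), with z = tanh (t/2). *)
Definition Aint s u : R :=
  \int[mu]_(t in `]0, +oo[) (polyA s t * polyA u t / Defs.sinh t).

Lemma AintC s u : Aint s u = Aint u s.
Proof. by apply: eq_Rintegral => t _; rewrite [polyA s t * _]mulrC. Qed.

Lemma continuous_polyAM s m u :
  continuous (fun t : R => polyA s t * polyA_sinh (m :: u) t).
Proof.
by move=> t; apply: cvgM; [exact: continuous_polyA|exact: continuous_polyA_sinh].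
Qed.

Lemma polyAM_integrable s m u : all (leq 1) s -> all (leq 1) (m :: u) ->
  mu.-integrable `[0, +oo[
    (EFin \o (fun t : R => polyA s t * polyA_sinh (m :: u) t)).
Proof.
move=> s1 u1; apply: exp_dominated_integrable.
  exact: continuous_polyAM.
exact: polyA_mul_dominated.
Qed.

Lemma AintE s m u : all (leq 1) s -> all (leq 1) (m :: u) ->
  Aint s (m :: u) = \int[mu]_(t in `[0, +oo[) (polyA s t * polyA_sinh (m :: u) t).
Proof.
move=> s1 u1; rewrite -Rintegral_itv_obnd_cbnd; last first.
  apply: integrableS (polyAM_integrable s1 u1) => //.
  by apply: subset_itvr; rewrite bnd_simp.
apply: eq_Rintegral => t; rewrite inE /= in_itv /= andbT => t0.
by rewrite polyA_sinhE// mulrA.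
Qed.

(** Integrates the derivative of A(m+1 :: s) A(l+1 :: u). Positivity of [m] and [l] makes both
    raised indices admissible, so the boundary product has a limit; it vanishes at t = 0. *)
Lemma Aint_by_parts m s l u : (0 < m)%N -> (0 < l)%N ->
  all (leq 1) s -> all (leq 1) u ->
  Aint (m :: s) (l.+1 :: u) =
  polyT (m.+1 :: s) * polyT (l.+1 :: u) - Aint (m.+1 :: s) (l :: u).
Proof.
case: m => // m _; case: l => // l _ s1 u1.
have ms1 k : all (leq 1) (k.+1 :: s) by rewrite /= s1.
have lu1 k : all (leq 1) (k.+1 :: u) by rewrite /= u1.
rewrite AintC !AintE//; apply/eqP; rewrite eq_sym subr_eq; apply/eqP.
rewrite -RintegralD//; [|exact: polyAM_integrable|exact: polyAM_integrable].
have df t : is_derive t 1 (fun t : R => polyA (m.+2 :: s) t * polyA (l.+2 :: u) t)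
    (polyA (l.+2 :: u) t * polyA_sinh (m.+1 :: s) t +
     polyA (m.+2 :: s) t * polyA_sinh (l.+1 :: u) t).
  apply: (is_derive_val (is_deriveMx (is_derive_polyA _ _ _)
    (is_derive_polyA _ _ _))).
  by rewrite addrC.
rewrite (@Rintegral_derive _ _ _
  (polyT (m.+2 :: s) * polyT (l.+2 :: u)) df).
- by rewrite !polyA_at0 mul0r subr0.
- by move=> t; apply: cvgD; exact: continuous_polyAM.
- have [C1 h1] := @polyA_mul_dominated R _ _ _ (lu1 l.+1) (ms1 m).
  have [C2 h2] := @polyA_mul_dominated R _ _ _ (ms1 m.+1) (lu1 l).
  exists (C1 + C2) => t t0; apply: le_trans (ler_normD _ _) _.
  by rewrite mulrDl; exact: lerD (h1 t t0) (h2 t t0).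
- by apply: cvgM; exact: polyA_cvg.
Qed.

Lemma Aint_swap m s l u : all (leq 1) s -> all (leq 1) u ->
  let a := m.+2 :: s in let b := l.+2 :: u in
  Aint (m.+1 :: s) (1%N :: b) = Aint (1%N :: a) (l.+1 :: u) +
   (polyT b * convT11 R (decr_last (rev a))
    - polyT a * convT11 R (decr_last (rev b))
    + 2 * parity_delta R (size a) (size b) * ln 2 * polyT a * polyT b).
Proof.
move=> s1 u1 a b.
have ms1 k : all (leq 1) (k.+1 :: s) by rewrite /= s1.
have lu1 k : all (leq 1) (k.+1 :: u) by rewrite /= u1.
have a1 : all (leq 1) (1%N :: a) by exact: ms1.
have b1 : all (leq 1) (1%N :: b) by exact: lu1.
rewrite AintC !AintE//; apply/eqP; rewrite addrC -subr_eq; apply/eqP.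
rewrite -RintegralB//; [|exact: polyAM_integrable|exact: polyAM_integrable].
(* An antisymmetric combination: A(b, 1)' = A(b) and A(a, 1)' = A(a), so the two terms A(a) A(b) in
   the derivative cancel. *)
pose W t : R := polyA a t * polyA (1%N :: b) t - polyA b t * polyA (1%N :: a) t.
have dW t : is_derive t 1 W (polyA (1%N :: b) t * polyA_sinh (m.+1 :: s) t -
     polyA (1%N :: a) t * polyA_sinh (l.+1 :: u) t).
  apply: (is_derive_val (is_deriveBx
    (is_deriveMx (is_derive_polyA m.+1 s t) (is_derive_polyA1 b t))
    (is_deriveMx (is_derive_polyA l.+1 u t) (is_derive_polyA1 a t)))).
  by rewrite -/a -/b; ring.
pose Ea : R := convT11 R (decr_last (rev a)) +
  (if odd (size a) then 2 * ln 2 * polyT a else 0).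
pose Eb : R := convT11 R (decr_last (rev b)) +
  (if odd (size b) then 2 * ln 2 * polyT b else 0).
have cW : (W t @[t --> +oo] --> polyT b * Ea - polyT a * Eb)%classic.
  have ha := @polyA_cvg R m s s1; have hb := @polyA_cvg R l u u1.
  have Ha := @polyA1_asymptotic R m s s1; have Hb := @polyA1_asymptotic R l u u1.
  have ta := @mul_polyA_tail_cvg0 R m s s1; have tb := @mul_polyA_tail_cvg0 R l u u1.
  rewrite -/a in ha Ha ta; rewrite -/b in hb Hb tb.
  rewrite -convT11_coef// -/a -/Ea in Ha; rewrite -convT11_coef// -/b -/Eb in Hb.
  (* [W] is regrouped so that every piece converges: the divergent T(a) T(b) t cancels, and
     replacing A by T next to a factor t costs a tail times t, which tends to 0. *)
  have HW : (polyT a * ((polyT b - polyA b t) * t) -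
      polyT b * ((polyT a - polyA a t) * t) -
      (polyA a t * (polyT b * t - polyA (1%N :: b) t) -
       polyA b t * (polyT a * t - polyA (1%N :: a) t)) @[t --> +oo] -->
      (polyT a * 0 - polyT b * 0 - (polyT a * Eb - polyT b * Ea) : R))%classic.
    by apply: cvgB; apply: cvgB; [exact: cvgMr|exact: cvgMr|exact: cvgM|exact: cvgM].
  rewrite !mulr0 subrr sub0r opprB in HW.
  rewrite (_ : W = fun t => polyT a * ((polyT b - polyA b t) * t) -
      polyT b * ((polyT a - polyA a t) * t) -
      (polyA a t * (polyT b * t - polyA (1%N :: b) t) -
       polyA b t * (polyT a * t - polyA (1%N :: a) t))); first exact: HW.
  by apply/funext => t; rewrite /W; ring.
rewrite (Rintegral_derive dW _ _ cW).
- rewrite /W !polyA_at0 !mul0r !subr0 /Ea /Eb /parity_delta.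
  (* The log 2 corrections enter as 2 log 2 T(a) T(b) with sign + for odd depth of [a] and - for odd
     depth of [b], which is [parity_delta]. *)
  by case: (odd (size a)); case: (odd (size b)) => /=; ring.
- move=> t; apply: cvgB; exact: continuous_polyAM.
- have [C1 h1] := @polyA_mul_dominated R _ _ _ b1 (ms1 m).
  have [C2 h2] := @polyA_mul_dominated R _ _ _ a1 (lu1 l).
  exists (C1 + C2) => t t0; apply: le_trans (ler_normB _ _) _.
  by rewrite mulrDl; exact: lerD (h1 t t0) (h2 t t0).
Qed.

Lemma Gamma_nat p : Gamma (p.+1%:R : R) = p`!%:R.
Proof.
rewrite /Gamma -natr1 addrK.
have -> : \int[mu]_(t in `]0, +oo[) (t `^ p%:R * expR (- t)) =
  \int[mu]_(t in `]0%R, +oo[) (t ^+ p * expR (- 1 * t)).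
  apply: eq_Rintegral => t; rewrite inE /= in_itv /= andbT => t0.
  by rewrite powR_mulrn ?ltW// mulN1r.
pose h n (t : R) := t ^+ n * expR (- 1 * t).
have ch n : continuous (h n).
  move=> t; apply: (is_derive_continuous
    (is_deriveMx (is_derive_exprn n t) (is_derive_expZ _ t))).
have hd n : exp_dominated (h n).
  exists ((2 * n%:R) ^+ n) => t t0.
  rewrite ger0_norm ?mulr_ge0 ?exprn_ge0 ?expR_ge0//.
  have := exprn_le_expR n t0 => H.
  have -> : expR (- 2^-1 * t) = expR (2^-1 * t) * expR (- 1 * t).
    by rewrite -expRD; congr expR; field.
  rewrite /h mulrA; by rewrite ler_wpM2r ?expR_ge0.
rewrite Rintegral_itv_obnd_cbnd; last first.
  apply: integrableS (exp_dominated_integrable (ch p) (hd p)) => //.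
  by apply: subset_itvr; rewrite bnd_simp.
have h0 n : (h n t @[t --> +oo] --> (0 : R))%classic.
  have [C hC] := hd n.
  (* Chosen so that the prefactor - 2 of [cvg_exp_half] gives |C|. *)
  have e2 := @cvg_exp_half R (- (`|C| / 2)).
  have e1 : ((fun _ : R => 0 : R) t @[t --> +oo] --> (0 : R))%classic.
    exact: cvg_cst.
  apply: squeeze_cvgr e1 e2; near=> t.
  have t0 : 0 <= t by near: t; exact: nbhs_pinfty_ge.
  rewrite /h mulr_ge0 ?exprn_ge0 ?expR_ge0//=.
  apply: le_trans (ler_norm _) _; apply: le_trans (hC t t0) _.
  rewrite (_ : -2 * _ * _ = `|C| * expR (- 2^-1 * t)).
    by rewrite ler_wpM2r ?expR_ge0// ler_norm.
  by field.
rewrite (_ : (fun t => t ^+ p * expR (-1 * t)) = h p)//; elim: p => [|p IH].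
  have d t : is_derive t 1 (fun t : R => -1 * expR (- 1 * t)) (h 0%N t).
    apply: (is_derive_val (is_deriveZx _ (is_derive_expZ _ _))).
    by rewrite /h expr0; ring.
  rewrite (Rintegral_derive d (ch 0%N) (hd 0%N) (l := 0)).
    by rewrite mulr0 expR0 fact0; ring.
  have E : (-1 * h 0%N t @[t --> +oo] --> (-1 * 0 : R))%classic.
    by apply: cvgMr; exact: h0.
  rewrite mulr0 in E.
  rewrite (_ : (fun t => -1 * expR (-1 * t)) = fun t => -1 * h 0%N t) //.
  by apply/funext => t; rewrite /h expr0 mul1r.
(* Integrating the derivative of - t^(p+1) exp (- t), which vanishes at both ends, gives the
   factorial recurrence. *)
have d t : is_derive t 1 (fun t : R => -1 * h p.+1 t)
    (h p.+1 t - p.+1%:R * h p t).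
  apply: (is_derive_val (is_deriveZx _
    (is_deriveMx (is_derive_exprn p.+1 t) (is_derive_expZ _ t)))).
  by rewrite /h /=; ring.
have hB : exp_dominated (fun t => h p.+1 t - p.+1%:R * h p t).
  have [C1 h1] := hd p.+1; have [C2 h2] := hd p.
  exists (C1 + p.+1%:R * C2) => t t0; apply: le_trans (ler_normB _ _) _.
  rewrite mulrDl lerD ?h1// normrM ger0_norm// -mulrA ler_wpM2l//.
  exact: h2.
have cB : continuous (fun t => h p.+1 t - p.+1%:R * h p t).
  by move=> t; apply: cvgB; [exact: ch|apply: cvgMr; exact: ch].
have cl : (-1 * h p.+1 t @[t --> +oo] --> (-1 * 0 : R))%classic.
  by apply: cvgMr; exact: h0.
have := Rintegral_derive d cB hB cl.
have ih n : mu.-integrable `[0, +oo[ (EFin \o h n).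
  exact: exp_dominated_integrable (ch n) (hd n).
have ihZ : mu.-integrable `[0, +oo[ (EFin \o (fun t => p.+1%:R * h p t)).
  apply: exp_dominated_integrable; first by move=> t; apply: cvgMr; exact: ch.
  have [C hC] := hd p; exists (p.+1%:R * C) => t t0.
  by rewrite normrM ger0_norm// -mulrA ler_wpM2l// hC.
rewrite RintegralB// RintegralZl// IH.
have -> : h p.+1 0 = 0 by rewrite /h expr0n mul0r.
by rewrite !mulr0 subrr factS natrM => /eqP; rewrite subr_eq0 => /eqP.
Unshelve. all: end_near. Qed.

End IntegralsOfProducts.

(** * Iteration over the entries of the index, and the theorem *)

Section IteratedParts.
Context {R : realType}.
Implicit Types (s t u L : seq nat).

Local Notation mu := (@lebesgue_measure R).

Lemma decr_last_rcons s m : decr_last (rcons s m) = rcons s m.-1.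
Proof.
by rewrite /decr_last size_rcons last_rcons -[X in take _ X]cats1 take_size_cat.
Qed.

Lemma psi_Aint p m u : all (leq 1) (m :: u) ->
  psi (rev (m :: u)) (p.+1%:R : R) = Aint (nseq p 1%N) (m :: u).
Proof.
move=> u1; have p1 : all (leq 1) (nseq p 1%N) by rewrite all_nseq orbT.
rewrite /psi Gamma_nat -[p.+1%:R]natr1 addrK.
have i0 : mu.-integrable `]0, +oo[
    (EFin \o (fun t : R => polyA (nseq p 1%N) t * polyA_sinh (m :: u) t)).
  apply: integrableS (polyAM_integrable p1 u1) => //.
  by apply: subset_itvr; rewrite bnd_simp.
have -> : Aint (nseq p 1%N) (m :: u) = \int[mu]_(t in `]0, +oo[)
    (polyA (nseq p 1%N) t * polyA_sinh (m :: u) t).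
  apply: eq_Rintegral => t; rewrite inE /= in_itv /= andbT => t0.
  by rewrite polyA_sinhE// mulrA.
have p0 : p`!%:R != 0 :> R by rewrite pnatr_eq0 -lt0n fact_gt0.
apply: (mulfI p0); rewrite mulVKf// -RintegralZl//.
apply: eq_Rintegral => t; rewrite inE /= in_itv /= andbT => t0.
rewrite polyA_multA polyA_sinhE// polyA_nseq1 powR_mulrn ?ltW//.
by rewrite [_ / p`!%:R]mulrC -[_^-1 * _ * _]mulrA mulVKf// mulrA.
Qed.

(** Each of m - 1 integrations by parts moves one unit from the last exponent of the right factor to
    that of the left; [m < x] keeps the right exponent positive. *)
Lemma Aint_row s u x m : all (leq 1) s -> all (leq 1) u ->
  (0 < m)%N -> (m < x)%N ->
  Aint (1%N :: s) (x.-1 :: u) =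
  \sum_(1 <= i < m) (-1) ^+ (i - 1) * polyT (i.+1 :: s) * polyT ((x - i)%N :: u)
  + (-1) ^+ (m - 1) * Aint (m :: s) ((x - m)%N :: u) :> R.
Proof.
move=> s1 u1; elim: m => // m IH _ mx.
case: m => [|m] in IH mx *.
  by rewrite big_geq// add0r subnn expr0 mul1r subn1.
have -> : \sum_(1 <= i < m.+2)
    (-1) ^+ (i - 1) * polyT (i.+1 :: s) * polyT ((x - i)%N :: u) =
  \sum_(1 <= i < m.+1)
    (-1) ^+ (i - 1) * polyT (i.+1 :: s) * polyT ((x - i)%N :: u) +
    (-1) ^+ (m.+1 - 1) * polyT (m.+2 :: s) * polyT ((x - m.+1)%N :: u) :> R.
  by rewrite big_nat_recr.
rewrite (IH isT (ltnW mx)).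
have -> : (x - m.+1 = (x - m.+2).+1)%N by lia.
have l0 : (0 < x - m.+2)%N by lia.
rewrite (Aint_by_parts (ltn0Sn m) l0 s1 u1).
have -> : (m.+2 - 1 = m.+1)%N by lia.
have -> : (m.+1 - 1 = m)%N by lia.
by rewrite exprS; ring.
Qed.

Definition row_sum x s u : R :=
  \sum_(1 <= i < x.-1)
    (-1) ^+ (i - 1) * polyT (i.+1 :: s) * polyT ((x - i)%N :: u).

Definition boundary_term s u : R :=
  polyT u * convT11 R (decr_last (rev s))
  - polyT s * convT11 R (decr_last (rev u))
  + 2 * parity_delta R (size s) (size u) * ln 2 * polyT s * polyT u.

Lemma Aint_row_sum x s u : (1 < x)%N -> all (leq 1) s -> all (leq 1) u ->
  Aint (1%N :: s) (x.-1 :: u) =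
  row_sum x s u + (-1) ^+ x * Aint (x.-1 :: s) (1%N :: u) :> R.
Proof.
move=> x1 s1 u1; have m0 : (0 < x.-1)%N by lia.
have mx : (x.-1 < x)%N by lia.
rewrite (Aint_row s1 u1 m0 mx).
have -> : (x - x.-1 = 1)%N by lia.
(* A full row consists of x - 2 integrations by parts, and x - 2 has the parity of x. *)
have -> : (-1) ^+ (x.-1 - 1) = (-1) ^+ x :> R.
  by case: x x1 {m0 mx} => [|[|x]] // _; rewrite subn1 /= !exprS mulrA mulrNN !mul1r.
by [].
Qed.

Lemma Aint_boundary x y s u : (1 < x)%N -> (1 < y)%N ->
  all (leq 1) s -> all (leq 1) u ->
  Aint (x.-1 :: s) [:: 1%N, y & u] =
  Aint [:: 1%N, x & s] (y.-1 :: u) + boundary_term (x :: s) (y :: u) :> R.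
Proof.
by case: x => [|[|x]] // _; case: y => [|[|y]] // _ s1 u1; exact: Aint_swap.
Qed.

(** A row takes the right head from x - 1 down to 1; [Aint_boundary] then restores the initial shape
    with [x] stacked on the left and the next entry reduced by 1 on the right. No boundary step
    follows the last row, hence one boundary term fewer than rows. *)
Lemma Aint_iterated L x s t : (1 < x)%N -> all (leq 2) L ->
  all (leq 1) s -> all (leq 1) t ->
  Aint (1%N :: s) (x.-1 :: L ++ t) =
  \sum_(0 <= j < (size L).+1) (-1) ^+ sumn (take j (x :: L)) *
    row_sum (nth 0%N (x :: L) j) (rev (take j (x :: L)) ++ s)
      (drop j.+1 (x :: L) ++ t)
  + \sum_(0 <= j < size L) (-1) ^+ sumn (take j.+1 (x :: L)) *
      boundary_term (rev (take j.+1 (x :: L)) ++ s) (drop j.+1 (x :: L) ++ t)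
  + (-1) ^+ sumn (x :: L) *
    Aint ((last x L).-1 :: rev (belast x L) ++ s) (1%N :: t) :> R.
Proof.
elim: L x s => [|y L IH] x s x1.
  move=> _ s1 t1; rewrite big_nat1 [X in _ + X + _]big_geq// addr0 mul1r.
  by rewrite [in RHS]/= addn0 (Aint_row_sum x1 s1 t1).
move=> /andP[y1 L2] s1 t1.
have L1 : all (leq 1) L by apply: sub_all L2 => i /ltnW.
have Lt1 : all (leq 1) (L ++ t) by rewrite all_cat L1.
have yL1 : all (leq 1) (y :: (L ++ t)) by rewrite /= Lt1 andbT ltnW.
have xs1 : all (leq 1) (x :: s) by rewrite /= s1 andbT ltnW.
rewrite cat_cons (Aint_row_sum x1 s1 yL1) (Aint_boundary x1 y1 s1 Lt1).
rewrite (IH y (x :: s) y1 L2 xs1 t1).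
rewrite [in RHS]big_nat_recl// [X in _ = _ + X + _]big_nat_recl//.
set S1 := \sum_(0 <= j < (size L).+1) _; set S2 := \sum_(0 <= j < size L) _.
have -> : \sum_(0 <= i < size (y :: L)) (-1) ^+ sumn (take i.+1 [:: x, y & L]) *
    row_sum (nth 0%N [:: x, y & L] i.+1) (rev (take i.+1 [:: x, y & L]) ++ s)
      (drop i.+2 [:: x, y & L] ++ t) = (-1) ^+ x * S1.
  rewrite /S1 mulr_sumr; apply: eq_bigr => i _.
  by rewrite mulrA -exprD [take i.+1 _]/= rev_cons cat_rcons.
have -> : \sum_(0 <= i < size L) (-1) ^+ sumn (take i.+2 [:: x, y & L]) *
    boundary_term (rev (take i.+2 [:: x, y & L]) ++ s)
      (drop i.+2 [:: x, y & L] ++ t) = (-1) ^+ x * S2.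
  rewrite /S2 mulr_sumr; apply: eq_bigr => i _.
  by rewrite mulrA -exprD [take i.+2 _]/= rev_cons cat_rcons.
have -> : (-1) ^+ sumn [:: x, y & L] = (-1) ^+ x * (-1) ^+ sumn (y :: L) :> R.
  by rewrite -exprD.
have -> : (last x (y :: L)).-1 :: rev (belast x (y :: L)) ++ s =
    (last y L).-1 :: rev (belast y L) ++ x :: s.
  by rewrite /= rev_cons cat_rcons.
rewrite take0 expr0 mul1r.
have -> : take 1 [:: x, y & L] = [:: x] by [].
have -> : drop 1 [:: x, y & L] = y :: L by [].
have -> : sumn [:: x] = x by rewrite /= addn0.
by rewrite /= !mulrDr; ring.
Qed.

End IteratedParts.

Theorem theorem3p4 (R : realType) (p q r : nat) (k : r.-tuple nat)
    (hp : (0 < p)%N) (hq : (0 < q)%N) (hr : (0 < r)%N)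
    (hk : forall i : 'I_r, (2 <= tnth k i)%N) :
  let K (j : nat) : nat := sumn (take j (rev k)) in
  let a (j : nat) : seq nat := nseq p.-1 1%N ++ take j.+1 (rev k) in
  let b (j : nat) : seq nat := nseq q.-1 1%N ++ take (r - j - 1)%N k in
  psi (decr_last (nseq q.-1 1%N ++ k)) (p.+1%:R : R)
  - (-1) ^+ sumn k * psi (decr_last (nseq p.-1 1%N ++ rev k)) (q.+1%:R : R)
  = \sum_(0 <= j < r)
      (-1) ^+ K j *
      \sum_(1 <= i < (nth 0%N k (r - j - 1)%N).-1)
        (-1) ^+ (i - 1)%N *
        multT R (nseq p.-1 1%N ++ rcons (take j (rev k)) i.+1) *
        multT R (nseq q.-1 1%N ++
                 rcons (take (r - j - 1)%N k) (nth 0%N k (r - j - 1)%N - i)%N)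
  + \sum_(0 <= j < (r - 1)%N)
      (-1) ^+ K j.+1 *
      (multT R (b j) * convT11 R (decr_last (a j))
       - multT R (a j) * convT11 R (decr_last (b j))
       + 2 * parity_delta R (p + j)%N (q + r - j - 2)%N * ln 2
         * multT R (a j) * multT R (b j)).
Proof.
move=> K a b.
have multTE c : multT R c = polyT (rev c) by rewrite multT_coef.
have sL : size (rev k) = r by rewrite size_rev size_tuple.
have L2 : all (leq 2) (rev k).
  by rewrite all_rev; apply/(all_tnthP (t := k)) => i; exact: hk.
have nth_kE j : (j < r)%N -> nth 0%N k (r - j - 1) = nth 0%N (rev k) j.
  by move=> jr; rewrite nth_rev ?size_tuple// -subnDA addn1.
have take_kE j : rev (take (r - j - 1) k) = drop j.+1 (rev k).
  by rewrite drop_rev size_tuple -subnDA addn1.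
have ones n : all (leq 1) (nseq n 1%N) by rewrite all_nseq orbT.
have onesS n : (0 < n)%N -> nseq n 1%N = 1%N :: nseq n.-1 1%N.
  by case: n.
have revb j : rev (b j) = drop j.+1 (rev k) ++ nseq q.-1 1%N.
  by rewrite rev_cat rev_nseq take_kE.
have reva j : rev (a j) = rev (take j.+1 (rev k)) ++ nseq p.-1 1%N.
  by rewrite rev_cat rev_nseq.
pose s := nseq p.-1 1%N; pose t := nseq q.-1 1%N.
have -> : \sum_(0 <= j < r) (-1) ^+ K j *
    \sum_(1 <= i < (nth 0%N k (r - j - 1)).-1) (-1) ^+ (i - 1) *
      multT R (s ++ rcons (take j (rev k)) i.+1) *
      multT R (t ++ rcons (take (r - j - 1) k) (nth 0%N k (r - j - 1) - i)%N) =
  \sum_(0 <= j < r) (-1) ^+ sumn (take j (rev k)) *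
    row_sum (nth 0%N (rev k) j) (rev (take j (rev k)) ++ s)
      (drop j.+1 (rev k) ++ t).
  apply: eq_big_nat => j /andP[_ jr]; congr (_ * _).
  rewrite nth_kE//; apply: eq_bigr => i _.
  by rewrite !multTE !rev_cat !rev_rcons !rev_nseq take_kE.
have -> : \sum_(0 <= j < r - 1) (-1) ^+ K j.+1 *
      (multT R (b j) * convT11 R (decr_last (a j))
       - multT R (a j) * convT11 R (decr_last (b j))
       + 2 * parity_delta R (p + j) (q + r - j - 2) * ln 2
         * multT R (a j) * multT R (b j)) =
  \sum_(0 <= j < r - 1) (-1) ^+ sumn (take j.+1 (rev k)) *
    boundary_term (rev (take j.+1 (rev k)) ++ s) (drop j.+1 (rev k) ++ t).
  apply: eq_big_nat => j /andP[_ jr]; congr (_ * _).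
  rewrite !multTE /boundary_term -reva -revb !revK; congr (_ + 2 * _ * _ * _ * _).
  (* The depths are (p - 1) + (j + 1) = p + j for [a j] and (q - 1) + (r - j - 1) = q + r - j - 2
     for [b j]. *)
  congr parity_delta; rewrite size_rev size_cat size_nseq size_take.
    by rewrite sL; case: ifP; lia.
  by rewrite size_tuple; case: ifP; lia.
have -> : sumn k = sumn (rev k) by rewrite sumn_rev.
move: sL L2; case E : (rev k) => [|x L] sL; first by move: hr sL => /=; lia.
move=> /andP[x2 L2].
have Ek : tval k = rev (x :: L) by rewrite -E revK.
have L1 : all (leq 1) L by apply: sub_all L2 => i /ltnW.
have -> : (r - 1 = size L)%N by rewrite -sL subn1.
have -> : psi (decr_last (t ++ k)) (p.+1%:R : R) =
    Aint (1%N :: s) (x.-1 :: L ++ t).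
  rewrite Ek rev_cons -rcons_cat decr_last_rcons.
  rewrite -onesS// -psi_Aint; last first.
    by rewrite /= all_cat L1 ones andbT; lia.
  by rewrite rev_cons rev_cat rev_nseq.
(* By symmetry of [Aint], the remaining integral of the iteration is a psi with the roles of [p] and
   [q] exchanged; [last x L] is k_1. *)
have -> : psi (decr_last (s ++ x :: L)) (q.+1%:R : R) =
    Aint ((last x L).-1 :: rev (belast x L) ++ s) (1%N :: t).
  have l2 : all (leq 2) (rcons (belast x L) (last x L)) by rewrite -lastI /= x2.
  move: l2; rewrite all_rcons => /andP[l2 b2].
  rewrite lastI -rcons_cat decr_last_rcons AintC -onesS// -psi_Aint; last first.
    rewrite /= all_cat all_rev ones andbT; apply/andP; split; first by lia.
    by apply: sub_all b2 => i /ltnW.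
  by rewrite rev_cons rev_cat revK rev_nseq.
by rewrite (Aint_iterated x2 L2 (ones _) (ones _)) addrK -sL.
Qed.
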